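(* Let $sp_\lambda$ be the character of $\mathit{Sp}(2m)$ corresponding to the partition $\lambda$, and let $g,h\in \mathit{Sp}(2m)$ have eigenvalues equal to $x_1,x_1^{-1},\ldots,x_m,x_m^{-1}$ and $y_1,y_1^{-1},\ldots,y_m,y_m^{-1}$, respectively. Then $$\sum_{\lambda} z^{|\lambda|}\, sp_{\lambda}(g)\,sp_{\lambda}(h) = \frac{(1-z^2)^m \det\left( \dfrac{1}{(1-z x_i y_j)(1-z x_i^{-1} y_j)(1-z x_i y_j^{-1})(1-z x_i^{-1} y_j^{-1})}\right)_{1\le i,j\le m}}{z^{\binom{m}{2}}\prod_{i<j} \left(y_i+y_i^{-1}-(y_j+y_j^{-1})\right) \prod_{i<j} \left(x_i+x_i^{-1}-(x_j+x_j^{-1})\right)},$$ where $\lambda$ runs over all partitions of non-negative integers with at most $m$ parts and $0<z<1$ is an arbitrary parameter.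
   Context: Here $m\ge 1$ is an integer, and the products over $i<j$ are over $1\le i<j\le m$. $\mathit{Sp}(2m)$ is the compact symplectic group of rank $m$, i.e. the group of unitary $2m\times 2m$ complex matrices preserving the standard nondegenerate alternating bilinear form; the eigenvalues of its elements come in pairs $x_i,x_i^{-1}$. A partition with at most $m$ parts is written $\lambda=(\lambda_1\ge\cdots\ge\lambda_m\ge 0)$ with integer entries, and $|\lambda|=\sum_i\lambda_i$. The irreducible representations of $\mathit{Sp}(2m)$ are labeled by such partitions. The character $sp_\lambda$ of the one labeled by $\lambda$ is given by the Weyl character formula $$sp_{\lambda}(g) = \frac{\det\left(x_{i}^{\lambda_j+m-j+1}-x_{i}^{-(\lambda_j+m-j+1)} \right)_{1\le i,j\le m}}{\det\left(x_{i}^{m-j+1}-x_{i}^{-(m-j+1)} \right)_{1\le i,j\le m}},$$ where $x_1,x_1^{-1},\ldots,x_m,x_m^{-1}$ are the eigenvalues of $g$. *)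

(* Defs.v *)
From mathcomp Require Import all_boot all_order all_algebra.
From mathcomp Require Import complex.
From mathcomp Require Import all_classical all_reals all_analysis.
From mathcomp Require Import showcase.summability.

Set Implicit Arguments.
Unset Strict Implicit.
Unset Printing Implicit Defensive.

Import Order.TTheory GRing.Theory Num.Theory.
Import numFieldNormedType.Exports.

Local Open Scope classical_set_scope.
Local Open Scope ring_scope.

(* R[i], kept behind its numClosedFieldType structure so that the topology
   MathComp-Analysis puts on every numClosedFieldType (the one of the modulus)
   is inferred; R[i] itself carries no topological instance. *)
Definition Cplx (R : realType) : numClosedFieldType := R[i]%C.

Definition mpartition (m : nat) := {l : m.-tuple nat | sorted geq l}.

Definition weight (m : nat) (l : mpartition m) : nat :=
  (\sum_(j < m) tnth (val l) j)%N.

Section Definitions.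
Variables (C : numClosedFieldType) (m : nat).
Implicit Types (x y : 'rV[C]_m) (g : 'M[C]_(m + m)) (l : mpartition m).

Definition symplectic_form : 'M[C]_(m + m) := block_mx 0 1%:M (- 1%:M) 0.

Definition Sp : set 'M[C]_(m + m) :=
  [set g | g \is unitarymx /\ g^T *m symplectic_form *m g = symplectic_form].

(* Multiplicities included. *)
Definition eigenpairs g x : Prop :=
  char_poly g =
    \prod_(i < m) (('X - (x 0 i)%:P) * ('X - ((x 0 i)^-1)%:P)).

(* MathComp convention: matrices act on row vectors on the right, and row
   spaces encode subspaces. *)
Record irreducible_rep (n : nat) (rho : 'M[C]_(m + m) -> 'M[C]_n) : Prop := {
  irr_dim : (0 < n)%N;
  irr_one : rho 1%:M = 1%:M;
  irr_mul : forall g h, Sp g -> Sp h -> rho (g *m h) = rho g *m rho h;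
  irr_cont : {within Sp, continuous rho};
  irr_simple : forall U : 'M[C]_n,
    (forall g, Sp g -> stablemx U (rho g)) -> U != 0 -> row_full U
}.

Definition irreducible_character (chi : 'M[C]_(m + m) -> C) : Prop :=
  exists (n : nat) (rho : 'M[C]_(m + m) -> 'M[C]_n),
    irreducible_rep rho /\ forall g, Sp g -> chi g = \tr (rho g).

(* The columns are numbered from 0, so the exponents m - j + 1 of the Weyl
   character formula read m - j here. *)
Definition weyl_num l x : C :=
  \det (\matrix_(i < m, j < m)
    (x 0 i ^+ (tnth (val l) j + (m - j)) - x 0 i ^- (tnth (val l) j + (m - j)))).

Definition weyl_den x : C :=
  \det (\matrix_(i < m, j < m) (x 0 i ^+ (m - j) - x 0 i ^- (m - j))).

(* chi is the irreducible character labeled by l. The Weyl formula fixes the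
   label; it is 0 / 0 where weyl_den vanishes, and there the values of chi are
   determined by continuity, irreducible characters being continuous. *)
Definition sp_character l (chi : 'M[C]_(m + m) -> C) : Prop :=
  irreducible_character chi /\
  forall g x, Sp g -> eigenpairs g x -> weyl_den x != 0 ->
    chi g = weyl_num l x / weyl_den x.

Definition cauchy_kernel (z a b : C) : C :=
  1 / ((1 - z * a * b) * (1 - z * a^-1 * b) *
       (1 - z * a * b^-1) * (1 - z * a^-1 * b^-1)).

Definition vander x : C :=
  \prod_(i < m) \prod_(j < m | (i < j)%N)
    (x 0 i + (x 0 i)^-1 - (x 0 j + (x 0 j)^-1)).

Definition cauchy_rhs (z : C) x y : C :=
  ((1 - z ^+ 2) ^+ m *
     \det (\matrix_(i < m, j < m) cauchy_kernel z (x 0 i) (y 0 j)))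
  / (z ^+ 'C(m, 2) * vander y * vander x).

(* The pairs of eigenvalue vectors of elements of Sp, which lie on the unit
   circle, at which the denominator of cauchy_rhs does not vanish. *)
Definition regular_pairs : set ('rV[C]_m * 'rV[C]_m) :=
  [set p : 'rV[C]_m * 'rV[C]_m |
     [/\ forall i, `|p.1 0 i| = 1, forall i, `|p.2 0 i| = 1,
         vander p.1 != 0 & vander p.2 != 0]].

End Definitions.

Arguments Sp : clear implicits.
Arguments regular_pairs : clear implicits.

(* Main.v *)
(** Put [t i = x i + (x i)^-1] and [U_k] for the Chebyshev polynomial with
    [U_k (t i) = (x i ^ (k+1) - x i ^ -(k+1)) / (x i - x i ^ -1)]. Newton
    interpolation of [U_k] at the nodes [t i] writes [\det (U_(k_j) (t i))] as the
    Vandermonde product in the [t i] times a determinant of complete symmetric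
    functions. The latter extends the Weyl quotient continuously to singular
    points; it is the value of the character there too, because every element of
    the symplectic group is diagonalized by a symplectic unitary matrix and its
    eigenvalues can be perturbed along the unit circle. By the Cauchy-Binet formula
    the series multiplied by the two Vandermonde products is the determinant of
    [\sum_k z^k U_k (t i) U_k (t' j)], a rational function of [z] found by
    telescoping. The determinants grow at most like [rho ^ |lambda|] on the torus
    for every [rho > 1], so the series converges uniformly there, which gives the
    limit at singular points. *)

Require Import Defs.
From mathcomp Require Import all_boot all_order all_algebra.
From mathcomp Require Import complex.
From mathcomp Require Import all_classical all_reals all_analysis.
From mathcomp Require Import showcase.summability.
From mathcomp Require Import finmap fingroup perm ring zify.

Set Implicit Arguments.
Unset Strict Implicit.
Unset Printing Implicit Defensive.

Import Order.TTheory GRing.Theory Num.Theory.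
Import numFieldNormedType.Exports.

Local Open Scope ring_scope.

(** * Complete symmetric functions as coefficients of generating series *)

Fixpoint geo (F : fieldType) (x : F) (a : nat -> F) (k : nat) : F :=
  if k is k'.+1 then a k'.+1 + x * geo x a k' else a 0%N.

(** On generating series in [q], [geo x] divides by [1 - x q], [qgeo x] divides by
    [(1 - x q) (1 - x^-1 q)], and [shift_seq] below multiplies by [q]. *)
Definition qgeo (F : fieldType) (x : F) (a : nat -> F) := geo x (geo x^-1 a).

Definition unit_seq (F : fieldType) (k : nat) : F := (k == 0%N)%:R.
Arguments unit_seq : clear implicits.

Definition shift_seq (F : fieldType) (a : nat -> F) (k : nat) : F :=
  if k is k'.+1 then a k' else 0.

(* The coefficients of [\prod_(x <- s) ((1 - x q) (1 - x^-1 q))^-1]. *)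
Definition hsym (F : fieldType) (s : seq F) : nat -> F :=
  foldr (@qgeo F) (unit_seq F) s.

(* [chebU x k] is the Chebyshev value
   [(x^(k+1) - x^-(k+1)) / (x - x^-1)], meaningful also at [x = 1, -1]. *)
Definition chebU (F : fieldType) (x : F) : nat -> F := hsym [:: x].

Section CompleteSymmetric.
Variable F : fieldType.
Implicit Types (x y w : F) (a b : nat -> F) (s : seq F).

Lemma geo_ext x a b : a =1 b -> geo x a =1 geo x b.
Proof. by move=> e; elim=> [|k IH] /=; rewrite ?IH ?e. Qed.

Lemma geo_unit x k : geo x (unit_seq F) k = x ^+ k.
Proof.
by elim: k => [|k IH] /=; rewrite /unit_seq /= ?expr0 // IH add0r exprS.
Qed.

Lemma qgeo0 x a : qgeo x a 0 = a 0%N. Proof. by []. Qed.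

Lemma qgeo1 x a : qgeo x a 1 = (x + x^-1) * a 0%N + a 1%N.
Proof. by rewrite /qgeo /=; ring. Qed.

(** The coefficient of [q^(k+2)] in [(1 - (x + x^-1) q + q^2) * qgeo x a = a]. *)
Lemma qgeoSS x a k : x != 0 ->
  qgeo x a k.+2 = (x + x^-1) * qgeo x a k.+1 - qgeo x a k + a k.+2.
Proof. by move=> x0; rewrite /qgeo /=; field. Qed.

(* Since [1 / D_x - 1 / D_y = (D_y - D_x) / (D_x D_y)] for
   [D_x = 1 - (x + x^-1) q + q^2]. *)
Lemma qgeoB x y a k : x != 0 -> y != 0 ->
  qgeo x a k - qgeo y a k =
  (x + x^-1 - (y + y^-1)) * shift_seq (qgeo x (qgeo y a)) k.
Proof.
move=> x0 y0; case: k => [|k]; first by rewrite /= !qgeo0 subrr mulr0.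
rewrite [shift_seq _ _]/=.
(* Both sides obey recurrences of order two, so the induction runs on consecutive pairs; its two
   initial cases are proved last. *)
suff: forall n, (n <= 1)%N -> forall k, (k <= n)%N ->
  qgeo x a k.+1 - qgeo y a k.+1 =
  (x + x^-1 - (y + y^-1)) * qgeo x (qgeo y a) k.
  move=> H0; have {}H0 := H0 1%N isT.
  suff: forall n, qgeo x a n.+1 - qgeo y a n.+1 =
      (x + x^-1 - (y + y^-1)) * qgeo x (qgeo y a) n /\
      qgeo x a n.+2 - qgeo y a n.+2 =
      (x + x^-1 - (y + y^-1)) * qgeo x (qgeo y a) n.+1.
    by move=> /(_ k) [].
  elim=> [|n [IH1 IH2]]; first by split; apply: H0.
  split=> //.
  rewrite (qgeoSS a n.+1 x0) (qgeoSS a n.+1 y0) (qgeoSS (qgeo y a) n x0).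
  rewrite (canRL (subrK _) IH1) (canRL (subrK _) IH2); ring.
move=> n n1 [|[|j]] jn; last by lia.
  by rewrite !qgeo1 !qgeo0; ring.
by rewrite !qgeoSS // !qgeo1 !qgeo0; ring.
Qed.

Lemma shift_seqB a b c k y :
  (forall k, a k - b k = y * c k) ->
  shift_seq a k - shift_seq b k = y * shift_seq c k.
Proof. by move=> e; case: k => [|k] /=; rewrite ?subrr ?mulr0. Qed.

Lemma iter_shift_seqB d a b c k y :
  (forall k, a k - b k = y * c k) ->
  iter d (@shift_seq F) a k - iter d (@shift_seq F) b k =
  y * iter d (@shift_seq F) c k.
Proof. by move=> e; elim: d k => //= d IH k; apply: shift_seqB. Qed.

Lemma iter_shift_seqE d a k :
  iter d (@shift_seq F) a k = if (d <= k)%N then a (k - d)%N else 0.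
Proof.
by elim: d k => [|d IH] [|k] //=; rewrite ?subn0 // IH subSS.
Qed.

Lemma hsym0 s : hsym s 0 = 1.
Proof. by elim: s => [|y s IH] //=; rewrite /unit_seq eqxx. Qed.

Lemma chebUE x k : x != 0 ->
  (x - x^-1) * chebU x k = x ^+ k.+1 - x ^- k.+1.
Proof.
move=> x0; rewrite /chebU /hsym /= /qgeo.
rewrite (geo_ext _ (geo_unit _)).
elim: k => [|k IH] /=; first by rewrite mulr1 !expr1.
rewrite mulrDr mulrCA IH.
have -> : x ^- k.+2 = x^-1 ^+ k.+2 by rewrite exprVn.
have -> : x ^- k.+1 = x^-1 ^+ k.+1 by rewrite exprVn.
rewrite !exprS; field.
by rewrite x0.
Qed.

End CompleteSymmetric.

(** * Newton interpolation of Chebyshev values *)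

Section Newton.
Variables (F : fieldType) (m : nat) (x : nat -> F).
Hypothesis x0 : forall p, x p != 0.

Local Notation suffix l := [seq x p | p <- index_iota l m].
Local Notation t w := (w + w^-1).

(* Newton interpolation at the nodes [t (x p)]: the divided differences of
   [chebU] are complete symmetric functions. *)
Lemma newton_expansion l w k : (l <= m)%N -> w != 0 ->
  chebU w k =
  \sum_(l <= j < m) (\prod_(j.+1 <= p < m) (t w - t (x p))) *
     iter (m.-1 - j) (@shift_seq F) (hsym (suffix j)) k
  + (\prod_(l <= p < m) (t w - t (x p))) *
     iter (m - l) (@shift_seq F) (hsym (w :: suffix l)) k.
Proof.
move=> lm w0; move: {2}(m - l)%N (erefl (m - l)%N) => d.
elim: d l lm => [|d IH] l lm e.
  have -> : l = m by lia.
  by rewrite !big_geq // subnn /= /index_iota subnn /= mul1r add0r.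
have lm' : (l < m)%N by lia.
rewrite (IH l.+1) //; last by lia.
have regroup (S T U Y : F) : Y = T + U -> S + Y = T + S + U.
  by move=> ->; rewrite addrCA addrA.
rewrite (big_ltn lm') [X in _ = X + _](big_ltn lm'); apply: regroup.
rewrite [X in _ = _ + X * _]mulrC -[X in _ = _ + X]mulrA -mulrDr.
congr (_ * _).
have -> : (m - l.+1 = m.-1 - l)%N by lia.
have -> : (m - l = (m.-1 - l).+1)%N by lia.
have sE : suffix l = x l :: suffix l.+1.
  by rewrite /index_iota -(subnSK lm').
rewrite iterSr.
(* [qgeoB] at [w] and [x l] splits the remainder for [l + 1]: the part at [x l] gives the new
   coefficient, the difference gives the remainder for [l]. *)
rewrite (canRL (subrK _) (iter_shift_seqB _ k
  (fun i => qgeoB (hsym (suffix l.+1)) i w0 (x0 l)))).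
by rewrite sE /= addrC.
Qed.

(** The divided difference at the nodes from [j] on: the complete symmetric function of degree
    [k - (m - 1 - j)] in these nodes and their inverses, zero when that degree is negative. *)
Definition newton_coef (j k : nat) : F :=
  iter (m.-1 - j) (@shift_seq F) (hsym (suffix j)) k.

(** At a node one factor of the remainder vanishes. *)
Lemma newton_expansion_node i k : (i < m)%N ->
  chebU (x i) k =
  \sum_(0 <= j < m) (\prod_(j.+1 <= p < m) (t (x i) - t (x p))) *
     newton_coef j k.
Proof.
move=> im; rewrite (newton_expansion k (leq0n m) (x0 i)).
have -> : \prod_(0 <= p < m) (t (x i) - t (x p)) = 0; last by rewrite mul0r addr0.
rewrite (bigD1_seq i) ?mem_index_iota ?iota_uniq //= subrr mul0r //.
Qed.
End Newton.

(** * The Cauchy-Binet formula, with subsets encoded as strictly decreasing maps *)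

Definition strict_dec (m N : nat) (f : {ffun 'I_m -> 'I_N}) : bool :=
  [forall i : 'I_m, forall j : 'I_m, (i < j)%N ==> (f j < f i)%N].

Lemma nth_codom_ord (T : Type) (m : nat) (f : 'I_m -> T) (i : 'I_m) (x0 : T) :
  nth x0 (codom f) i = f i.
Proof.
rewrite codomE (nth_map i) ?size_enum_ord //; congr (f _); exact: nth_ord_enum.
Qed.

Section CauchyBinet.
Variables (R : comNzRingType) (m N : nat).
Implicit Types (f d : {ffun 'I_m -> 'I_N}) (s : 'S_m).

Local Notation gtI := (fun a b : 'I_N => (b < a)%N).

Lemma strict_decP f :
  reflect (forall i j : 'I_m, (i < j)%N -> (f j < f i)%N) (strict_dec f).
Proof.
apply: (iffP forallP) => [H i j ij|H i].
  by move/forallP: (H i) => /(_ j) /implyP; apply.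
by apply/forallP => j; apply/implyP; apply: H.
Qed.

Lemma strict_dec_inj f : strict_dec f -> injective f.
Proof.
move=> /strict_decP H i j e; apply/val_inj/eqP.
by case: (ltngtP i j) => // /H; rewrite e ltnn.
Qed.

Lemma strict_dec_sorted f : strict_dec f -> sorted gtI (codom f).
Proof.
move=> /strict_decP H; rewrite codomE.
apply: (homo_sorted (e := fun i j : 'I_m => (i < j)%N)) => //.
have := iota_ltn_sorted 0 m; rewrite -val_enum_ord sorted_map; exact.
Qed.

Lemma codom_compP d s : codom [ffun i => d (s i)] =i codom d.
Proof.
move=> k; apply/codomP/codomP => [[i ->]|[i ->]]; rewrite ?ffunE.
  by exists (s i).
by exists (s^-1%g i); rewrite ffunE permKV.
Qed.

(** The image, listed in sorted order, determines the decreasing map; injectivity of that map then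
    determines the permutation. *)
Lemma dec_comp_inj d d' s s' : strict_dec d -> strict_dec d' ->
  [ffun i => d (s i)] = [ffun i => d' (s' i)] -> (d, s) = (d', s').
Proof.
move=> hd hd' e.
have cE : codom d = codom d'.
  apply: (@sorted_eq _ gtI).
  - by move=> a b c ab bc; apply: ltn_trans bc ab.
  - by move=> a b /andP[ab ba]; have := ltn_trans ab ba; rewrite ltnn.
  - exact: strict_dec_sorted.
  - exact: strict_dec_sorted.
  apply: uniq_perm.
  - by apply/injectiveP/strict_dec_inj.
  - by apply/injectiveP/strict_dec_inj.
  by move=> k; rewrite -(codom_compP d s) e codom_compP.
have dE : d = d'.
  apply/ffunP => i; have := congr1 (fun l => nth (d i) l i) cE.
  by rewrite !nth_codom_ord.
rewrite -dE in e *; congr (_, _); apply/permP => i.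
by have /ffunP /(_ i) := e; rewrite !ffunE => /(strict_dec_inj hd).
Qed.

(** [d] lists the image of [f] in decreasing order, and [s] undoes the sorting. *)
Lemma dec_comp_surj f : injective f ->
  exists d s, strict_dec d /\ f = [ffun i => d (s i)].
Proof.
move=> fi.
pose geI := fun a b : 'I_N => (b <= a)%N.
pose t := sort geI (codom f).
have tN : size t == m by rewrite size_sort size_codom card_ord.
have tot : total geI by move=> a b; apply: leq_total.
have tr : transitive geI by move=> a b c ab bc; apply: leq_trans bc ab.
have [p pE] : exists p : 'S_m, codom f = [tuple tnth (Tuple tN) (p i) | i < m].
  have cN : size (codom f) == m by rewrite size_codom card_ord.
  by apply/(@tuple_permP _ _ (codom f) (Tuple tN)); rewrite /= perm_sym perm_sort.
exists [ffun i => tnth (Tuple tN) i], p; split.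
  apply/strict_decP => i j ij; rewrite !ffunE.
  have ge : (tnth (Tuple tN) j <= tnth (Tuple tN) i)%N.
    have [k0] : exists k0 : 'I_N, true by exists (f i).
    rewrite !(tnth_nth k0) /= => _.
    apply: (sorted_leq_nth tr (fun a => leqnn a)) => //.
    - exact: sort_sorted.
    - by rewrite inE (eqP tN).
    - by rewrite inE (eqP tN).
    - exact: ltnW.
  rewrite ltn_neqAle ge andbT; apply/eqP => /val_inj.
  have /tuple_uniqP tinj : uniq (Tuple tN) by rewrite /= sort_uniq; apply/injectiveP.
  by move/tinj => ji; move: ij; rewrite ji ltnn.
apply/ffunP => i; rewrite !ffunE.
have := congr1 (fun l => nth (f i) l i) pE.
rewrite nth_codom_ord => ->.
by rewrite -[RHS](tnth_mktuple (fun i => tnth (Tuple tN) (p i)) i) (tnth_nth (f i)).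
Qed.

(** Multilinearity in the rows of [A *m B] gives a sum over all maps [f]. A map that is not
    injective repeats a row of [B]; an injective one is uniquely a decreasing map after a
    permutation, and the sums over permutations are the minors of [A]. *)
Lemma Cauchy_Binet (A : 'M[R]_(m, N)) (B : 'M[R]_(N, m)) :
  \det (A *m B) =
  \sum_(f | strict_dec f) \det (colsub f A) * \det (rowsub f B).
Proof.
transitivity (\sum_(f : {ffun 'I_m -> 'I_N}) (\prod_i A i (f i)) * \det (rowsub f B)).
  rewrite /(\det (_ *m _)).
  under eq_bigr => s _.
    under eq_bigr do rewrite mxE.
    rewrite bigA_distr_bigA big_distrr /=.
    under eq_bigr => f _ do rewrite big_split /= mulrCA.
    over.
  rewrite exchange_big /=; apply: eq_bigr => f _.
  rewrite -big_distrr /=; congr (_ * _); apply: eq_bigr => s _.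
  by congr (_ * _); apply: eq_bigr => i _; rewrite mxE.
rewrite (bigID (fun f : {ffun 'I_m -> 'I_N} => injectiveb f)) /= addrC big1 ?add0r; last first.
  move=> f /injectivePn[i [j ij e]].
  rewrite (@determinant_alternate _ _ _ i j) ?mulr0 // => k.
  by rewrite !mxE e.
pose h (p : {ffun 'I_m -> 'I_N} * 'S_m) : {ffun 'I_m -> 'I_N} := [ffun i => p.1 (p.2 i)].
pose D := [set p : {ffun 'I_m -> 'I_N} * 'S_m | strict_dec p.1].
have hD : [set f : {ffun 'I_m -> 'I_N} | injectiveb f] = [set h p | p in D].
  apply/finset.setP => f; rewrite inE;
    apply/injectiveP/imsetP => [/dec_comp_surj [d [s [ds ->]]]|[[d s]]].
    by exists (d, s); rewrite ?inE.
  rewrite inE /= => ds -> i j; rewrite !ffunE => /(strict_dec_inj ds) /perm_inj; exact.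
rewrite (eq_bigl (fun f => f \in [set f : {ffun 'I_m -> 'I_N} | injectiveb f]));
  last by move=> f; rewrite inE.
rewrite hD big_imset /=; last first.
  move=> [d s] [d' s']; rewrite !inE /= => hd hd'; exact: dec_comp_inj.
rewrite (eq_bigl (fun p => strict_dec p.1 && true)); last by move=> p; rewrite inE andbT.
rewrite -(pair_big_dep (fun d => strict_dec d) (fun _ _ => true)
  (fun d s => (\prod_i A i ((h (d, s)) i)) * \det (rowsub (h (d, s)) B))) /=.
apply: eq_bigr => d _.
rewrite /(\det (colsub _ _)) big_distrl /=; apply: eq_bigr => s _.
have -> : rowsub (h (d, s)) B = row_perm s (rowsub d B).
  by apply/matrixP => i j; rewrite !mxE ffunE.
rewrite row_permE det_mulmx det_perm mulrA; congr (_ * _).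
rewrite mulrC; congr (_ * _); apply: eq_bigr => i _.
by rewrite !mxE ffunE.
Qed.

End CauchyBinet.

(** * The Weyl quotient as a determinant of complete symmetric functions *)

Section JacobiTrudi.
Variables (C : numClosedFieldType) (m : nat).
Implicit Types (x : 'rV[C]_m) (k : 'I_m -> nat) (l : mpartition m).

(* Extended by the junk value 1 outside ['I_m]. *)
Definition nat_ext x (p : nat) : C := oapp (x 0) 1 (insub p).

Lemma nat_extE x (i : 'I_m) : nat_ext x i = x 0 i.
Proof. by rewrite /nat_ext valK. Qed.

(* The Jacobi-Trudi form of the symplectic character; unlike the quotient of
   the Weyl determinants it makes sense at every [x] without zero entry. *)
Definition newton_det k x : C :=
  \det (\matrix_(i < m, j < m) newton_coef m (nat_ext x) i (k j)).

(** The matrix of Newton products is triangular, since the [j]-th product vanishes at the nodes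
    after [j]; its diagonal multiplies to the Vandermonde product. *)
Lemma det_chebU k x : (forall i, x 0 i != 0) ->
  \det (\matrix_(i < m, j < m) chebU (x 0 i) (k j)) = vander x * newton_det k x.
Proof.
move=> x0.
have y0 p : nat_ext x p != 0.
  by rewrite /nat_ext; case: insubP => [i _ _|_] /=; rewrite ?oner_neq0.
pose t w : C := w + w^-1.
pose A := \matrix_(i < m, j < m)
  \prod_(j.+1 <= p < m) (t (x 0 i) - t (nat_ext x p)).
have -> : \matrix_(i < m, j < m) chebU (x 0 i) (k j) =
    A *m \matrix_(i < m, j < m) newton_coef m (nat_ext x) i (k j).
  apply/matrixP => i j; rewrite !mxE -nat_extE (newton_expansion_node y0 _ (ltn_ord i)).
  by rewrite big_mkord; apply: eq_bigr => p _; rewrite !mxE nat_extE.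
rewrite det_mulmx -det_tr det_trig; last first.
  apply/is_trig_mxP => j i ji; rewrite !mxE.
  rewrite (bigD1_seq (val i)) ?mem_index_iota ?iota_uniq ?ji ?ltn_ord //=.
  by rewrite nat_extE subrr mul0r.
congr (_ * _); apply: eq_bigr => i _; rewrite !mxE.
rewrite (big_nat_widenl _ 0%N) // big_mkord; apply: eq_bigr => j _.
by rewrite nat_extE.
Qed.

(** The case of the empty partition, hence of the Weyl denominator: the matrix is triangular with
    [h_0 = 1] on the diagonal. *)
Lemma newton_det_stair x : newton_det (fun j => m.-1 - j)%N x = 1.
Proof.
rewrite /newton_det det_trig.
  apply: big1 => i _; rewrite mxE /newton_coef iter_shift_seqE leqnn subnn.
  exact: hsym0.
apply/is_trig_mxP => i j ij; rewrite mxE /newton_coef iter_shift_seqE.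
by case: ifP => //; have := ltn_ord j; lia.
Qed.

(** One less than the exponent in [weyl_num], because [chebU x k] has numerator
    [x^(k+1) - x^-(k+1)]. *)
Definition part_exp l (j : 'I_m) : nat := (tnth (val l) j + (m.-1 - j))%N.

Lemma det_weyl (k : 'I_m -> nat) x : (forall i, x 0 i != 0) ->
  \det (\matrix_(i < m, j < m) (x 0 i ^+ (k j).+1 - x 0 i ^- (k j).+1)) =
  (\prod_i (x 0 i - (x 0 i)^-1)) * (vander x * newton_det k x).
Proof.
move=> x0; rewrite -det_chebU //.
have -> : \prod_i (x 0 i - (x 0 i)^-1) = \det (diag_mx (\row_i (x 0 i - (x 0 i)^-1))).
  by rewrite det_diag; apply: eq_bigr => i _; rewrite mxE.
rewrite -det_mulmx mul_diag_mx; congr (\det _); apply/matrixP => i j.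
by rewrite !mxE chebUE.
Qed.

Lemma weyl_denE x : (forall i, x 0 i != 0) ->
  weyl_den x = (\prod_i (x 0 i - (x 0 i)^-1)) * vander x.
Proof.
move=> x0; have := det_weyl (fun j : 'I_m => m.-1 - j)%N x0.
rewrite newton_det_stair mulr1 => <-.
rewrite /weyl_num /weyl_den; congr (\det _); apply/matrixP => i j; rewrite !mxE.
by have -> : (m - j = (m.-1 - j).+1)%N by have := ltn_ord j; lia.
Qed.

Lemma weyl_numE l x : (forall i, x 0 i != 0) ->
  weyl_num l x = weyl_den x * newton_det (part_exp l) x.
Proof.
move=> x0; rewrite weyl_denE // -mulrA -det_weyl //.
rewrite /weyl_num /weyl_den; congr (\det _); apply/matrixP => i j; rewrite !mxE /part_exp.
have -> : (m - j = (m.-1 - j).+1)%N by have := ltn_ord j; lia.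
by rewrite addnS.
Qed.

End JacobiTrudi.

(** * The finite Cauchy identity and the telescoping of its kernel *)

Section CauchyKernel.
Variable C : numClosedFieldType.
Implicit Types (x y z : C) (N : nat).

(** The Chebyshev recurrence; the shift supplies [U_(-1) = 0] when [N = 0]. *)
Lemma chebU_rec x N : x != 0 ->
  chebU x N.+1 = (x + x^-1) * chebU x N - shift_seq (chebU x) N.
Proof.
move=> x0; case: N => [|N] /=.
  by rewrite /chebU /= qgeo1 qgeo0 /unit_seq /=; ring.
by rewrite /chebU /= qgeoSS // /unit_seq /= addr0.
Qed.

(* The boundary term of the telescoping sum below: the bilinear form [B] in
   [(U_N, U_(N-1))(x)] and [(U_N, U_(N-1))(y)] with [D U_N U_N = z B_(N+1) - B_N]. *)
Definition kernel_rest z x y N : C :=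
  let a := chebU x N in let a' := shift_seq (chebU x) N in
  let b := chebU y N in let b' := shift_seq (chebU y) N in
  - (1 - z ^+ 2) * a * b
  + z * (x + x^-1 - z * (y + y^-1)) * a * b'
  + z * (y + y^-1 - z * (x + x^-1)) * a' * b
  - z * (1 - z ^+ 2) * a' * b'.

Lemma kernel_sum z x y N : x != 0 -> y != 0 ->
  ((1 - z * x * y) * (1 - z * x^-1 * y) * (1 - z * x * y^-1) *
     (1 - z * x^-1 * y^-1)) *
    (\sum_(k < N) z ^+ k * chebU x k * chebU y k) =
  1 - z ^+ 2 + z ^+ N * kernel_rest z x y N.
Proof.
move=> x0 y0; elim: N => [|N IH].
  by rewrite big_ord0 /kernel_rest /chebU /= /qgeo /= /unit_seq /=; ring.
rewrite big_ord_recr /= mulrDr IH /kernel_rest !chebU_rec //= [z ^+ N.+1]exprS.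
move: (chebU x N) (chebU y N) (shift_seq _ N) (shift_seq _ N) => a b a' b'.
move: (z ^+ N) => w; by field; rewrite x0 y0.
Qed.

(** Cauchy-Binet for Chebyshev matrices truncated to [k < N], the weights [z ^ k] being put into the
    left factor. *)
Lemma Cauchy_sum m (x y : 'rV[C]_m) z N :
  (forall i, x 0 i != 0) -> (forall i, y 0 i != 0) ->
  vander x * vander y *
    (\sum_(f : {ffun 'I_m -> 'I_N} | strict_dec f)
       z ^+ (\sum_j f j)%N * newton_det (fun j => f j) x * newton_det (fun j => f j) y) =
  \det (\matrix_(i < m, j < m)
     \sum_(k < N) z ^+ k * chebU (x 0 i) k * chebU (y 0 j) k).
Proof.
move=> x0 y0.
pose A := \matrix_(i < m, k < N) (z ^+ k * chebU (x 0 i) k).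
pose B := \matrix_(k < N, j < m) chebU (y 0 j) k.
have -> : \matrix_(i < m, j < m)
    (\sum_(k < N) z ^+ k * chebU (x 0 i) k * chebU (y 0 j) k) = A *m B.
  by apply/matrixP => i j; rewrite !mxE; apply: eq_bigr => k _; rewrite !mxE.
rewrite Cauchy_Binet mulr_sumr; apply: eq_bigr => f _.
have -> : \det (colsub f A) = z ^+ (\sum_j f j) * (vander x * newton_det (fun j => f j) x).
  rewrite -det_chebU // -det_tr.
  have -> : (colsub f A)^T = diag_mx (\row_j z ^+ f j) *m
      (\matrix_(i, j) chebU (x 0 i) (f j))^T.
    by rewrite mul_diag_mx; apply/matrixP => i j; rewrite !mxE.
  rewrite det_mulmx det_tr det_diag; congr (_ * _).
  by rewrite expr_sum; apply: eq_bigr => j _; rewrite mxE.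
have -> : \det (rowsub f B) = vander y * newton_det (fun j => f j) y.
  rewrite -det_chebU // -det_tr; congr (\det _).
  by apply/matrixP => i j; rewrite !mxE.
ring.
Qed.

End CauchyKernel.

(** * Growth bounds on the unit torus *)

Section Bounds.
Variables (C : numClosedFieldType) (rho : C).
Hypothesis rho1 : 1 < rho.

Local Notation K := (rho / (rho - 1)).

Let rho_gt0 : 0 < rho. Proof. exact: lt_trans rho1. Qed.

Lemma ratio_ge1 : 1 <= K.
Proof. by rewrite ler_pdivlMr ?subr_gt0 // mul1r gerBl ler01. Qed.

(** The constant satisfies [K = 1 + K / rho], which is what the recursion of [geo] asks for when
    [|x| = 1]. *)
Lemma geo_bound (x B : C) (a : nat -> C) k : `|x| = 1 -> 0 <= B ->
  (forall k, `|a k| <= B * rho ^+ k) -> `|geo x a k| <= K * B * rho ^+ k.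
Proof.
move=> x1 B0 aB; elim: k => [|k IH] /=.
  apply: (le_trans (aB 0%N)); rewrite !expr0 !mulr1 ler_peMl //; exact: ratio_ge1.
apply: (le_trans (ler_normD _ _)); rewrite normrM x1 mul1r.
have -> : K * B * rho ^+ k.+1 = B * rho ^+ k.+1 + K * B * rho ^+ k.
  by rewrite exprS; field; rewrite subr_eq0 gt_eqF.
exact: lerD.
Qed.

Lemma hsym_bound (s : seq C) k : all (fun x => `|x| == 1) s ->
  `|hsym s k| <= K ^+ (2 * size s) * rho ^+ k.
Proof.
have rk j : 0 <= rho ^+ j by rewrite exprn_ge0 // ltW.
have K0 : 0 <= K by apply: le_trans ratio_ge1; exact: ler01.
elim: s k => [|x s IH] k /=.
  move=> _; rewrite muln0 expr0 mul1r /unit_seq normr_nat.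
  case: k => [|k] /=; first by rewrite expr0.
  exact: rk.
move=> /andP[/eqP x1 /IH {}IH]; rewrite /qgeo.
have B0 : 0 <= K ^+ (2 * size s) by rewrite exprn_ge0.
have x1' : `|x^-1| = 1 by rewrite normfV x1 invr1.
have := geo_bound k x1 (mulr_ge0 K0 B0) (fun k => geo_bound k x1' B0 IH).
by rewrite mulnS exprD expr2 !mulrA.
Qed.

Lemma newton_coef_bound m (x : nat -> C) j k : (forall p, `|x p| = 1) ->
  `|newton_coef m x j k| <= K ^+ (2 * m) * rho ^+ k.
Proof.
move=> x1; rewrite /newton_coef iter_shift_seqE.
have K1 := ratio_ge1.
have K0 : 0 <= K by apply: le_trans K1; exact: ler01.
case: ifP => [le|_]; last by rewrite normr0 mulr_ge0 ?exprn_ge0 // ltW.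
apply: le_trans (hsym_bound _ _) _; first by apply/allP => _ /mapP[p _ ->]; rewrite x1.
apply: ler_pM; rewrite ?exprn_ge0 ?(ltW rho_gt0) //.
  apply: ler_weXn2l => //; rewrite size_map size_iota leq_mul2l; lia.
apply: ler_weXn2l; [exact: ltW|lia].
Qed.

(** The Leibniz expansion has [m!] products of [m] entries. [B] is chosen before [x] and [k], so the
    bound is uniform on the torus. *)
Lemma newton_det_bound m : exists2 B : C, 0 <= B &
  forall (x : 'rV[C]_m) (k : 'I_m -> nat), (forall i, `|x 0 i| = 1) ->
  `|newton_det k x| <= B * rho ^+ (\sum_j k j).
Proof.
have K1 := ratio_ge1.
have K0 : 0 <= K by apply: le_trans K1; exact: ler01.
exists ((m`!)%:R * (K ^+ (2 * m)) ^+ m); first by rewrite mulr_ge0 ?exprn_ge0 ?ler0n.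
move=> x k x1.
have y1 p : `|nat_ext x p| = 1.
  by rewrite /nat_ext; case: insubP => [i _ _|_] /=; rewrite ?normr1.
apply: le_trans (ler_norm_sum _ _ _) _.
have -> : (m`!)%:R * K ^+ (2 * m) ^+ m * rho ^+ (\sum_j k j) =
    \sum_(s : 'S_m) K ^+ (2 * m) ^+ m * rho ^+ (\sum_j k j).
  by rewrite sumr_const card_Sn mulr_natl mulrnAl.
apply: ler_sum => s _; rewrite normrM normrX normrN1 expr1n mul1r normr_prod.
have -> : K ^+ (2 * m) ^+ m * rho ^+ (\sum_j k j) =
    \prod_(i < m) (K ^+ (2 * m) * rho ^+ (k (s i))).
  rewrite big_split /= prodr_const card_ord; congr (_ * _).
  rewrite -expr_sum; congr (_ ^+ _).
  by rewrite (reindex_inj (@perm_inj _ s)).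
apply: ler_prod => i _; rewrite normr_ge0 mxE /=.
exact: newton_coef_bound.
Qed.

Lemma kernel_rest_bound (z x y : C) N : `|z| <= 1 -> `|x| = 1 -> `|y| = 1 ->
  `|kernel_rest z x y N| <= 12%:R * (K ^+ 2 * rho ^+ N) ^+ 2.
Proof.
move=> z1 x1 y1.
have K1 := ratio_ge1.
have K0 : 0 <= K by apply: le_trans K1; exact: ler01.
have B0 : 0 <= K ^+ 2 * rho ^+ N by rewrite mulr_ge0 ?exprn_ge0 // ltW.
have ub (w : C) k : `|w| = 1 -> `|chebU w k| <= K ^+ 2 * rho ^+ k.
  by move=> w1; rewrite -{1}[2%N]muln1; apply: hsym_bound; rewrite /= w1 eqxx.
have us (w : C) : `|w| = 1 -> `|shift_seq (chebU w) N| <= K ^+ 2 * rho ^+ N.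
  case: (N) => [|k] w1 /=; first by rewrite normr0 mulr_ge0 ?exprn_ge0 // ltW.
  apply: le_trans (ub _ _ w1) _; rewrite ler_wpM2l ?exprn_ge0 //.
  by apply: ler_weXn2l; [exact: ltW|].
have t2 (w : C) : `|w| = 1 -> `|w + w^-1| <= 2%:R.
  by move=> w1; apply: le_trans (ler_normD _ _) _; rewrite normfV w1 invr1.
have tt (w v : C) : `|w| = 1 -> `|v| = 1 -> `|z * (w + w^-1 - z * (v + v^-1))| <= 4%:R.
  move=> w1 v1; rewrite normrM -[4%:R]mul1r; apply: ler_pM => //.
  apply: le_trans (ler_normB _ _) _; rewrite normrM.
  have -> : 4%:R = 2%:R + 1 * 2%:R :> C by rewrite mul1r -natrD.
  by apply: lerD; [exact: t2|apply: ler_pM => //; exact: t2].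
have zz : `|1 - z ^+ 2| <= 2%:R.
  apply: le_trans (ler_normB _ _) _; rewrite normr1 normrX.
  rewrite (natrD _ 1 1).
  by rewrite lerD2l exprn_ile1.
have prd (X c a b d : C) : `|c| <= d -> `|a| <= X -> `|b| <= X ->
    `|c * a * b| <= d * X ^+ 2.
  move=> cd aB bB; rewrite !normrM expr2 mulrA; apply: ler_pM; rewrite ?mulr_ge0 //.
  exact: ler_pM.
rewrite /kernel_rest.
(* The coefficients of the four terms of [kernel_rest] have modulus at most 2, 4, 4 and 2. *)
have split12 (X : C) : 12%:R * X = 2%:R * X + 4%:R * X + 4%:R * X + 2%:R * X by ring.
rewrite split12.
apply: le_trans (ler_normB _ _) _; apply: lerD; last first.
  apply: prd; rewrite ?us // normrM -[2%:R]mul1r; exact: ler_pM.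
apply: le_trans (ler_normD _ _) _; apply: lerD; last by apply: prd; rewrite ?us ?ub ?tt.
apply: le_trans (ler_normD _ _) _; apply: lerD; last by apply: prd; rewrite ?us ?ub ?tt.
by apply: prd; rewrite ?normrN ?ub.
Qed.

End Bounds.

Local Open Scope classical_set_scope.

(** * Continuity of the determinants in the eigenvalues *)

Section Continuity.
Variables (C : numClosedFieldType) (T : Type) (F : set_system T).
Hypothesis FF : Filter F.

Lemma cvg_sum_seq (I : Type) (r : seq I) (P : pred I) (f : I -> T -> C) (a : I -> C) :
  (forall i, P i -> f i x @[x --> F] --> a i) ->
  \sum_(i <- r | P i) f i x @[x --> F] --> \sum_(i <- r | P i) a i.
Proof. by move=> H; apply: cvg_big => //; exact: add_continuous. Qed.

Lemma cvg_prod_seq (I : Type) (r : seq I) (P : pred I) (f : I -> T -> C) (a : I -> C) :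
  (forall i, P i -> f i x @[x --> F] --> a i) ->
  \prod_(i <- r | P i) f i x @[x --> F] --> \prod_(i <- r | P i) a i.
Proof. by move=> H; apply: cvg_big => //; exact: mul_continuous. Qed.

Lemma cvg_det n (A : T -> 'M[C]_n) (B : 'M[C]_n) :
  (forall i j, A x i j @[x --> F] --> B i j) ->
  \det (A x) @[x --> F] --> \det B.
Proof.
move=> AB; apply: cvg_sum_seq => s _; apply: cvgM; first exact: cvg_cst.
by apply: cvg_prod_seq => i _; apply: AB.
Qed.

Lemma cvg_geo (x : T -> C) (x' : C) (a : T -> nat -> C) (a' : nat -> C) :
  x t @[t --> F] --> x' -> (forall k, a t k @[t --> F] --> a' k) ->
  forall k, geo (x t) (a t) k @[t --> F] --> geo x' a' k.
Proof.
move=> xx aa; elim=> [|k IH] /=; first exact: aa.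
by apply: cvgD; [exact: aa|apply: cvgM].
Qed.

Lemma cvg_hsym (I : Type) (s : seq I) (x : T -> I -> C) (x' : I -> C) k :
  (forall i, x t i @[t --> F] --> x' i) -> (forall i, x' i != 0) ->
  hsym [seq x t i | i <- s] k @[t --> F] --> hsym [seq x' i | i <- s] k.
Proof.
move=> xx x0; elim: s k => [|i s IH] k /=; first exact: cvg_cst.
apply: cvg_geo; first exact: xx.
move=> k'; apply: (@cvg_geo (fun t => (x t i)^-1)); last exact: IH.
by apply: cvgV; [exact: x0|exact: xx].
Qed.

(** The entries are polynomials in the [x i] and their inverses, hence continuous also where traces
    [x i + (x i)^-1] coincide. *)
Lemma cvg_newton_det m (x : T -> 'rV[C]_m) (x' : 'rV[C]_m) k :
  (forall i, x t 0 i @[t --> F] --> x' 0 i) -> (forall i, x' 0 i != 0) ->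
  newton_det k (x t) @[t --> F] --> newton_det k x'.
Proof.
move=> xx x0; apply: cvg_det => i j; rewrite mxE.
rewrite (_ : (fun t => _) = fun t => newton_coef m (nat_ext (x t)) i (k j)); last first.
  by apply: funext => t; rewrite mxE.
rewrite /newton_coef iter_shift_seqE.
rewrite (_ : (fun t => _) = fun t =>
   if (m.-1 - i <= k j)%N then
     hsym [seq nat_ext (x t) p | p <- index_iota i m] (k j - (m.-1 - i))
   else 0); last by apply: funext => t; rewrite iter_shift_seqE.
case: ifP => _; last exact: cvg_cst.
apply: cvg_hsym => p; rewrite /nat_ext; case: insubP => [q _ _|_] //=.
exact: cvg_cst.
Qed.

End Continuity.

Lemma cvg_mx_coord (C : numClosedFieldType) (T : Type) (F : set_system T)
    (FF : Filter F) m n (A : T -> 'M[C]_(m, n)) (B : 'M[C]_(m, n)) :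
  (forall i j, A x i j @[x --> F] --> B i j) -> A x @[x --> F] --> B.
Proof.
move=> AB U [/= V BV VU]; apply: filterS; first by move=> x; exact: VU.
apply: (filter_forall FF) => i; apply: (filter_forall FF) => j.
by apply: AB; apply: BV.
Qed.

(** * Partitions as decreasing exponent maps, and finite boxes of partitions *)

Section Boxes.
Variable m : nat.
Implicit Types (l : mpartition m).

Lemma sum_part_exp l : (\sum_j part_exp l j = weight l + 'C(m, 2))%N.
Proof.
rewrite /part_exp big_split /=; congr (_ + _)%N.
rewrite -bin2_sum big_mkord (reindex_inj rev_ord_inj) /=.
by apply: eq_bigr => i _; have := ltn_ord i; lia.
Qed.

Lemma part_sortedP (t : m.-tuple nat) :
  reflect (forall i j : 'I_m, (i <= j)%N -> (tnth t j <= tnth t i)%N) (sorted geq t).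
Proof.
have tr : transitive geq by move=> a b c ab bc; apply: leq_trans bc ab.
apply: (iffP idP) => [st i j ij|H].
  rewrite !(tnth_nth 0%N); apply: (sorted_leq_nth tr (fun a => leqnn a) 0%N st) => //;
  by rewrite inE size_tuple.
apply/(sortedP 0%N) => i; rewrite size_tuple => im.
have := H (Ordinal (ltnW im)) (Ordinal im) (leqnSn _).
by rewrite !(tnth_nth 0%N).
Qed.

Lemma part_exp_dec l (i j : 'I_m) : (i < j)%N -> (part_exp l j < part_exp l i)%N.
Proof.
move=> ij; have /part_sortedP/(_ i j (ltnW ij)) := valP l.
rewrite /part_exp; have := ltn_ord j; have := ltn_ord i; lia.
Qed.

Lemma part_exp_inj l l' : part_exp l =1 part_exp l' -> l = l'.
Proof.
move=> e; apply/val_inj/eq_from_tnth => j; have := e j; rewrite /part_exp; lia.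
Qed.

Lemma part0_proof : sorted geq [tuple 0%N | _ < m].
Proof. by apply/part_sortedP => i j _; rewrite !tnth_mktuple. Qed.

Definition part0 : mpartition m := Sub [tuple 0%N | _ < m] part0_proof.

(** Inverse to [part_exp] on strictly decreasing maps, where [m - 1 - j <= f j] rules out truncated
    subtraction and the default [part0] is not met. *)
Definition dec_part N (f : {ffun 'I_m -> 'I_N}) : mpartition m :=
  insubd part0 [tuple (f j - (m.-1 - j))%N | j < m].

Lemma strict_dec_gap N (f : {ffun 'I_m -> 'I_N}) (i j : 'I_m) :
  strict_dec f -> (i <= j)%N -> (f j + (j - i) <= f i)%N.
Proof.
move=> /strict_decP H; move: {2}(j - i)%N (erefl (j - i)%N) => d.
elim: d j => [|d IH] j e ij.
  have -> : j = i by apply: val_inj => /=; lia.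
  by rewrite subnn addn0.
have jm : (j.-1 < m)%N by have := ltn_ord j; lia.
have := IH (Ordinal jm); rewrite /= => /(_ _ _).
have := H (Ordinal jm) j; rewrite /= => H1 H2.
have {}H1 : (f j < f (Ordinal jm))%N by apply: H1; lia.
have : (f (Ordinal jm) + (j.-1 - i) <= f i)%N by apply: H2; lia.
lia.
Qed.

Lemma dec_partK N (f : {ffun 'I_m -> 'I_N}) j : strict_dec f ->
  part_exp (dec_part f) j = f j.
Proof.
move=> fd; have low (i : 'I_m) : (m.-1 - i <= f i)%N.
  have mm : (m.-1 < m)%N by have := ltn_ord i; lia.
  have := @strict_dec_gap _ _ i (Ordinal mm) fd; have := ltn_ord i => /=; lia.
rewrite /part_exp /dec_part insubdK ?tnth_mktuple ?subnK //.
apply/part_sortedP => a b ab; rewrite !tnth_mktuple.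
by have := strict_dec_gap fd ab; have := low a; have := low b;
  have := ltn_ord a; have := ltn_ord b; lia.
Qed.

(** The partitions whose shifted exponents are all below [N], exactly those occurring in
    [Cauchy_sum]; every partition lies in a large box. *)
Definition box N : {fset mpartition m} :=
  [fset @dec_part N f | f in [pred f | strict_dec f]]%fset.

Lemma mem_box N l : (forall j, part_exp l j < N)%N -> l \in box N.
Proof.
move=> lN; apply/imfsetP; exists [ffun j => Ordinal (lN j)].
  by apply/strict_decP => i j ij; rewrite !ffunE; apply: part_exp_dec.
apply: part_exp_inj => j; rewrite dec_partK ?ffunE //.
by apply/strict_decP => a b ab; rewrite !ffunE; apply: part_exp_dec.
Qed.

(** Every shifted exponent is at most [weight l + m], so the weight is large outside a box. *)
Lemma notin_box_weight N l : l \notin box N -> (N <= weight l + m)%N.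
Proof.
apply: contraR; rewrite -ltnNge => lN; apply: mem_box => j.
apply: leq_ltn_trans lN; rewrite /part_exp leq_add //; last lia.
by rewrite /weight (bigD1 j) //= leq_addr.
Qed.

Lemma box_mono N M : (N <= M)%N -> (box N `<=` box M)%fset.
Proof.
move=> NM; apply/fsubsetP => l /imfsetP[f fd ->]; apply: mem_box => j.
by rewrite dec_partK //; apply: leq_trans NM.
Qed.

Lemma partial_sum_seq (V : zmodType) (g : mpartition m -> V) A :
  partial_sum g A = \sum_(l <- A) g l.
Proof. by rewrite /partial_sum big_seq_fsetE. Qed.

Lemma sum_box (V : zmodType) (g : mpartition m -> V) N :
  partial_sum g (box N) = \sum_(f : {ffun 'I_m -> 'I_N} | strict_dec f) g (dec_part f).
Proof.
rewrite partial_sum_seq big_imfset /=; last first.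
  move=> f f' fd fd' e; apply/ffunP => j; apply: val_inj => /=.
  by rewrite -!dec_partK // e.
by rewrite big_enum.
Qed.

End Boxes.

(** * Tail estimates for sums over partitions *)

Section Tails.
Variables (C : numClosedFieldType) (m : nat) (r : C).
Hypotheses (r0 : 0 < r) (r1 : r < 1).
Implicit Types (l : mpartition m) (f : mpartition m -> C).

Let omr : 0 < 1 - r. Proof. by rewrite subr_gt0. Qed.

Lemma geometric_sum_le N : \sum_(k < N) r ^+ k <= (1 - r)^-1.
Proof.
rewrite -[leRHS]div1r ler_pdivlMr // mulrC.
have -> : (1 - r) * \sum_(k < N) r ^+ k = 1 - r ^+ N.
  by rewrite -opprB mulNr -subrX1 opprB.
by rewrite gerBl exprn_ge0 // ltW.
Qed.

(** Without the order condition the sum runs over all [m]-tuples with entries up to the largest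
    weight [M], and is a product of [m] geometric sums. *)
Lemma sum_weight_le (s : seq (mpartition m)) : uniq s ->
  \sum_(l <- s) r ^+ weight l <= (1 - r)^-1 ^+ m.
Proof.
move=> us; set M := \max_(l <- s) weight l.
pose phi l : {ffun 'I_m -> 'I_M.+1} := [ffun j => inord (tnth (val l) j)].
have le l j : l \in s -> (tnth (val l) j < M.+1)%N.
  move=> ls; rewrite ltnS; apply: leq_trans (leq_bigmax_seq _ ls _) => //.
  by rewrite /weight (bigD1 j) //= leq_addr.
have phiE l j : l \in s -> phi l j = tnth (val l) j :> nat.
  by move=> ls; rewrite ffunE inordK // le.
have uphi : uniq (map phi s).
  rewrite map_inj_in_uniq // => l l' ls ls' e; apply: part_exp_inj => j.
  by rewrite /part_exp -!phiE // e.
have -> : \sum_(l <- s) r ^+ weight l = \sum_(h <- map phi s) \prod_j r ^+ h j.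
  rewrite big_map; apply: eq_big_seq => l ls; rewrite expr_sum.
  by apply: eq_bigr => j _; rewrite phiE.
rewrite big_uniq //=.
have nn (h : {ffun 'I_m -> 'I_M.+1}) : 0 <= \prod_j r ^+ h j.
  by apply: prodr_ge0 => j _; rewrite exprn_ge0 // ltW.
apply: (@le_trans _ _ (\sum_(h : {ffun 'I_m -> 'I_M.+1}) \prod_j r ^+ h j)).
  rewrite [leRHS](bigID (mem (map phi s))) /= lerDl.
  by apply: sumr_ge0 => h _; apply: nn.
rewrite -(bigA_distr_bigA (fun (_ : 'I_m) (k : 'I_M.+1) => r ^+ k)).
rewrite -[in leRHS](card_ord m) -prodr_const.
apply: ler_prod => j _; rewrite geometric_sum_le andbT.
by apply: sumr_ge0 => k _; rewrite exprn_ge0 // ltW.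
Qed.

(** Of the two factors [r ^ weight l], one is at most [r ^ (N - m)] outside the box and the other
    makes the sum converge. *)
Lemma partial_sum_tail (B : C) f N A : 0 <= B ->
  (forall l, `|f l| <= B * (r ^+ 2) ^+ weight l) -> (box m N `<=` A)%fset ->
  `|partial_sum f A - partial_sum f (box m N)| <=
  B * (1 - r)^-1 ^+ m * r ^+ (N - m).
Proof.
move=> B0 fB /fsubsetP sub; rewrite !partial_sum_seq.
rewrite (bigID (mem (box m N))) /=.
have -> : \sum_(l <- A | l \in box m N) f l = \sum_(l <- box m N) f l.
  rewrite -big_filter; apply: perm_big; apply: uniq_perm.
  - by rewrite filter_uniq // fset_uniq.
  - exact: fset_uniq.
  by move=> l; rewrite mem_filter; apply: andb_idr => /sub.
rewrite addrAC subrr add0r -big_filter.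
set s := [seq l <- _ | _].
have us : uniq s by rewrite filter_uniq // fset_uniq.
apply: le_trans (ler_norm_sum _ _ _) _.
apply: (@le_trans _ _ (\sum_(l <- s) B * r ^+ (N - m) * r ^+ weight l)).
  rewrite !big_seq; apply: ler_sum => l; rewrite mem_filter => /andP[lN _].
  apply: le_trans (fB l) _; rewrite -mulrA ler_wpM2l // -exprM mulSn mul1n exprD.
  rewrite ler_wpM2r ?exprn_ge0 ?(ltW r0) //.
  apply: ler_wiXn2l; rewrite ?(ltW r0) ?(ltW r1) //.
  by have := notin_box_weight lN; lia.
rewrite -mulr_sumr mulrAC ler_wpM2r ?exprn_ge0 ?(ltW r0) //.
by rewrite ler_wpM2l // sum_weight_le.
Qed.

End Tails.

(** * Completeness of the complex numbers with an explicit rate *)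

Section ComplexCompleteness.
Variable R : realType.
Local Notation C := (Cplx R).

Lemma complex_norm_le (w : C) : `|w| <= ((`|complex.Re w| + `|complex.Im w|)%:C)%C.
Proof.
case: w => a b /=; rewrite {1}(complexE (a +i* b)%C) /=.
apply: le_trans (ler_normD _ _) _; rewrite normrM rmorphD /=.
rewrite !normc_def /= !(expr0n, addr0, sqrtr_sqr, add0r) /=.
by rewrite normr1 rmorph1 mul1r.
Qed.

Lemma complex_norm_ge_Im (w : C) : ((`|complex.Im w|)%:C)%C <= `|w|.
Proof.
have := normc_ge_Re ((w : R[i]) * 'i%C); rewrite ReiNIm normrN normrM.
rewrite (normc_def 'i%C) /= expr0n add0r expr1n sqrtr1 mulr1; apply.
Qed.

Lemma complex_expr_small (t : R) (e : C) : 0 <= t < 1 -> 0 < e ->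
  \forall n \near \oo, (t%:C)%C ^+ n < e.
Proof.
(* In the order on complex numbers, [0 < e] forces the imaginary part to vanish. *)
move=> /andP[t0 t1]; case: e => a b; rewrite ltcE /= => /andP[/eqP -> a0].
have /cvgrPdist_lt /(_ a a0) : (fun n => t ^+ n) @ \oo --> (0 : R).
  by apply: cvg_expr; rewrite ger0_norm.
apply: filterS => n; rewrite sub0r normrN ger0_norm ?exprn_ge0 // => tn.
by rewrite -rmorphXn /= ltcR.
Qed.

Lemma Cplx_cauchy (u : nat -> C) (e : nat -> C) :
  (forall eps, 0 < eps -> \forall n \near \oo, e n < eps) ->
  (forall n k, (n <= k)%N -> `|u k - u n| <= e n) ->
  exists s, forall n, `|s - u n| <= e n.
Proof.
move=> esmall ucauchy.
have part (p : C -> R) : (forall w v, p (w - v) = p w - p v) ->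
    (forall w, (`|p w|%:C)%C <= `|w|) -> cvg ((p \o u) @ \oo).
  move=> pB pn; apply/cauchy_cvgP/cauchy_exP => d d0.
  have d20 : 0 < (d%:C)%C :> C by rewrite ltcR.
  have [n _ en] := esmall _ d20.
  exists (p (u n)); exists n => // k /= nk; rewrite /ball /= distrC -pB -ltcR.
  apply: le_lt_trans (pn _) _; apply: le_lt_trans (ucauchy _ _ nk) _.
  exact: (en n (leqnn n)).
have /cvg_ex[a /= ua] : cvg ((@complex.Re R \o u) @ \oo).
  by apply: (part (@complex.Re R)) => [w v|w];
    [exact: (raddfB (@complex.Re R))|exact: normc_ge_Re].
have /cvg_ex[b /= ub] : cvg ((@complex.Im R \o u) @ \oo).
  by apply: (part (@complex.Im R)) => [w v|w];
    [exact: (raddfB (@complex.Im R))|exact: complex_norm_ge_Im].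
pose s : C := (a +i* b)%C.
have us eps : 0 < eps -> \forall k \near \oo, `|s - u k| < eps.
  case: eps => d d'; rewrite ltcE /= => /andP[/eqP -> d0].
  have d20 : 0 < d / 2 by rewrite divr_gt0.
  move/cvgrPdist_lt: ua => /(_ _ d20) ua; move/cvgrPdist_lt: ub => /(_ _ d20) ub.
  near=> k; apply: le_lt_trans (complex_norm_le _) _; rewrite ltcR (splitr d).
  rewrite (raddfB (@complex.Re R)) (raddfB (@complex.Im R)).
  by apply: ltrD; near: k; [exact: ua|exact: ub].
exists s => n.
have e0 : 0 <= e n by apply: le_trans (ucauchy n n (leqnn n)).
(* If the bound failed at [n], a later term closer to [s] than the gap would break the triangle
   inequality, its distance to [u n] being at most [e n]. *)
rewrite real_leNgt ?ger0_real //; apply/negP => lt.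
have gap : 0 < `|s - u n| - e n by rewrite subr_gt0.
have [k _ /(_ (maxn n k))] := us _ gap.
rewrite /= leq_maxr => /(_ isT); rewrite ltrBrDr => /lt_le_trans H.
have := H (`|s - u (maxn n k)| + `|u (maxn n k) - u n|).
rewrite ltrD2l.
have -> : s - u n = (s - u (maxn n k)) + (u (maxn n k) - u n) by rewrite subrKA.
move=> /(_ (ler_normD _ _)) /(le_lt_trans (ucauchy _ _ (leq_maxl n k))).
by rewrite ltxx.
Unshelve. all: by end_near. Qed.

End ComplexCompleteness.

(** * Uniform convergence of the series and its sum at regular points *)

Section Series.
Variables (R : realType) (m : nat) (z : R).
Hypotheses (z0 : 0 < z) (z1 : z < 1).
Local Notation C := (Cplx R).
Local Notation zC := ((z%:C)%C : C).
Implicit Types x y : 'rV[C]_m.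

Definition on_torus x := forall i, `|x 0 i| = 1.

Definition newton_term x y (l : mpartition m) : C :=
  zC ^+ weight l * newton_det (part_exp l) x * newton_det (part_exp l) y.

(** With [r] the fourth root of [z] and [rho = r^-1], the two determinants cost [r^-2] per unit of
    weight, which leaves [z * r^-2 = r^2], the rate in [partial_sum_tail]. *)
Let q : R := Num.sqrt (Num.sqrt z).
Let r : C := (q%:C)%C.

Let q0 : 0 < q. Proof. by rewrite !sqrtr_gt0. Qed.
Let q1 : q < 1.
Proof. by rewrite -sqrtr1 ltr_sqrt // -sqrtr1 ltr_sqrt. Qed.
Let r0 : 0 < r. Proof. by rewrite ltcR. Qed.
Let r1 : r < 1. Proof. by rewrite ltcR. Qed.
Let zr : zC = r ^+ 4.
Proof.
rewrite -rmorphXn /= (exprM q 2 2) sqr_sqrtr ?sqrtr_ge0 // sqr_sqrtr //.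
exact: ltW.
Qed.
Let rho1 : 1 < r^-1. Proof. by rewrite invf_gt1. Qed.

Lemma torus_neq0 x : on_torus x -> forall i, x 0 i != 0.
Proof. by move=> x1 i; rewrite -normr_gt0 x1. Qed.

Lemma complex_geom_small (t : R) (c e : C) : 0 <= t < 1 -> 0 <= c -> 0 < e ->
  \forall n \near \oo, c * (t%:C)%C ^+ n < e.
Proof.
(* Dividing by [c + 1] covers the case [c = 0]. *)
move=> t01 c0 e0; have c1 : 0 < c + 1 by rewrite ltr_wpDl.
have := complex_expr_small t01 (divr_gt0 e0 c1).
apply: filterS => n; rewrite ltr_pdivlMr // mulrC; apply: le_lt_trans.
rewrite ler_wpM2r ?lerDl // exprn_ge0 // ler0c.
by case/andP: t01.
Qed.

Lemma newton_term_bound : exists2 B : C, 0 <= B &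
  forall x y, on_torus x -> on_torus y ->
  forall l, `|newton_term x y l| <= B * (r ^+ 2) ^+ weight l.
Proof.
have [B B0 HB] := newton_det_bound rho1 m.
have b0 : 0 <= B * (r^-1) ^+ 'C(m, 2) by rewrite mulr_ge0 // exprn_ge0 // invr_ge0 ltW.
exists ((B * (r^-1) ^+ 'C(m, 2)) ^+ 2); first by rewrite exprn_ge0.
move=> x y x1 y1 l; rewrite /newton_term !normrM normrX.
have -> : `|zC| = zC by rewrite ger0_norm // ler0c ltW.
have -> : (B * r^-1 ^+ 'C(m, 2)) ^+ 2 * (r ^+ 2) ^+ weight l =
    zC ^+ weight l * (B * r^-1 ^+ (weight l + 'C(m, 2))) *
    (B * r^-1 ^+ (weight l + 'C(m, 2))).
  rewrite zr !exprD !exprVn (exprAC r 2) (exprAC r 4).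
  have : r ^+ weight l != 0 by rewrite expf_neq0 // gt_eqF.
  have : r ^+ 'C(m, 2) != 0 by rewrite expf_neq0 // gt_eqF.
  move: (r ^+ 'C(m, 2)) (r ^+ weight l) => a b a0 bb0.
  by field; rewrite a0 bb0.
have bnd w : on_torus w ->
    `|newton_det (part_exp l) w| <= B * r^-1 ^+ (weight l + 'C(m, 2)).
  by move=> w1; rewrite -sum_part_exp; apply: HB.
have zw : 0 <= zC ^+ weight l by rewrite exprn_ge0 // ler0c ltW.
apply: ler_pM; rewrite ?mulr_ge0 ?bnd //.
by rewrite ler_wpM2l ?bnd.
Qed.

(** The rate [e] is common to all points of the torus; the limit at singular points rests on this
    uniformity. *)
Lemma newton_series : exists2 e : nat -> C,
  forall eps, 0 < eps -> \forall n \near \oo, e n < eps &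
  forall x y, on_torus x -> on_torus y -> exists s, forall N A,
    (box m N `<=` A)%fset -> `|s - partial_sum (newton_term x y) A| <= e N.
Proof.
have [B B0 HB] := newton_term_bound.
pose D := B * (1 - r)^-1 ^+ m.
have D0 : 0 <= D.
  by rewrite mulr_ge0 // exprn_ge0 // invr_ge0 subr_ge0 ltW.
pose E N := D * r ^+ (N - m).
have small (c eps : C) : 0 <= c -> 0 < eps -> \forall n \near \oo, c * E n < eps.
  move=> c0 e0.
  have q01 : 0 <= q < 1 by rewrite q1 ltW.
  have [N _ HN] := complex_geom_small q01 (mulr_ge0 c0 D0) e0.
  exists (N + m)%N => // n /= nN; rewrite mulrA; apply: HN => /=.
  by rewrite leq_subRL ?(leq_trans (leq_addl _ _) nN) // addnC.
(* One [E n] for the terms of [A] outside the box, one for the distance from the box sum to the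
   limit. *)
exists (fun n => 2%:R * E n); first by move=> eps; apply: small; rewrite ler0n.
move=> x y x1 y1.
have tail N A : (box m N `<=` A)%fset ->
    `|partial_sum (newton_term x y) A - partial_sum (newton_term x y) (box m N)|
    <= E N.
  exact: (partial_sum_tail r0 r1 B0 (HB x y x1 y1)).
have [s Hs] : exists s, forall N,
    `|s - partial_sum (newton_term x y) (box m N)| <= E N.
  apply: Cplx_cauchy.
    move=> eps e0; have := small 1 eps ler01 e0.
    by apply: filterS => n; rewrite mul1r.
  by move=> n k nk; apply/tail/box_mono.
exists s => N A NA.
rewrite -(subrKA (partial_sum (newton_term x y) (box m N))).
apply: le_trans (ler_normD _ _) _.
by rewrite mulr_natl mulr2n lerD // distrC tail.
Qed.

(** By [kernel_sum] the error is [z^N * kernel_rest / D], of order [r^(2 N)]. [D] is nonzero since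
    each of its factors is 1 minus a number of modulus [z < 1]. *)
Lemma cvg_kernel_sum (a b : C) : `|a| = 1 -> `|b| = 1 ->
  (\sum_(k < N) zC ^+ k * chebU a k * chebU b k) @[N --> \oo] -->
  (1 - zC ^+ 2) * cauchy_kernel zC a b.
Proof.
move=> a1 b1.
have zn : `|zC| = zC by rewrite ger0_norm // ler0c ltW.
have a0 : a != 0 by rewrite -normr_gt0 a1.
have b0 : b != 0 by rewrite -normr_gt0 b1.
have fac (u v : C) : `|u| = 1 -> `|v| = 1 -> 1 - zC * u * v != 0.
  move=> u1 v1; rewrite subr_eq0; apply/eqP => e.
  have := congr1 Num.norm e; rewrite !normrM zn u1 v1 normr1 !mulr1 => ez.
  have : zC < 1 by rewrite ltcR.
  by rewrite -ez ltxx.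
have a1' : `|a^-1| = 1 by rewrite normfV a1 invr1.
have b1' : `|b^-1| = 1 by rewrite normfV b1 invr1.
set D := (1 - zC * a * b) * (1 - zC * a^-1 * b) * (1 - zC * a * b^-1) *
     (1 - zC * a^-1 * b^-1).
have D0 : D != 0 by rewrite !mulf_neq0 // fac.
have -> : (1 - zC ^+ 2) * cauchy_kernel zC a b = D^-1 * (1 - zC ^+ 2 + 0).
  by rewrite addr0 /cauchy_kernel -/D div1r mulrC.
have -> : (fun N => \sum_(k < N) zC ^+ k * chebU a k * chebU b k) =
    (fun N => D^-1 * (1 - zC ^+ 2 + zC ^+ N * kernel_rest zC a b N)).
  by apply: funext => N; rewrite -kernel_sum // mulKf.
apply: cvgM; first exact: cvg_cst.
apply: cvgD; first exact: cvg_cst.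
pose K := r^-1 / (r^-1 - 1).
have K0 : 0 <= 12%:R * K ^+ 4.
  by rewrite mulr_ge0 ?ler0n // exprn_ge0 // (le_trans ler01) // ratio_ge1.
apply/cvgrPdist_le => eps eps0.
have q01 : 0 <= q ^+ 2 < 1 by rewrite exprn_ge0 ?(ltW q0) //= exprn_ilt1 // ltW.
have := complex_geom_small q01 K0 eps0; apply: filterS => N /ltW; apply: le_trans.
rewrite sub0r normrN normrM normrX zn.
have zN : 0 <= zC ^+ N by rewrite exprn_ge0 // ler0c ltW.
have z1' : `|zC| <= 1 by rewrite zn lecR ltW.
apply: le_trans (ler_wpM2l zN (kernel_rest_bound rho1 N z1' a1 b1)) _.
rewrite -/K zr rmorphXn /= -/r (exprAC r 2) (exprAC r 4).
have : r ^+ N != 0 by rewrite expf_neq0 // gt_eqF.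
rewrite exprVn; move: (r ^+ N) => w w0.
by rewrite le_eqVlt; apply/orP; left; apply/eqP; field.
Qed.

(** The shifted exponents of [l] add up to [weight l + 'C(m, 2)], whence the extra power of [z]. *)
Lemma sum_box_newton_term x y N : on_torus x -> on_torus y ->
  vander x * vander y * (zC ^+ 'C(m, 2) * partial_sum (newton_term x y) (box m N)) =
  \det (\matrix_(i < m, j < m)
     \sum_(k < N) zC ^+ k * chebU (x 0 i) k * chebU (y 0 j) k).
Proof.
move=> x1 y1; rewrite -Cauchy_sum; [|exact: torus_neq0|exact: torus_neq0].
congr (_ * _); rewrite sum_box mulr_sumr; apply: eq_bigr => f fd.
have e w : newton_det (part_exp (dec_part f)) w = newton_det (fun j => f j) w.
  by congr (\det _); apply/matrixP => i j; rewrite !mxE dec_partK.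
rewrite /newton_term !e !mulrA -exprD addnC -sum_part_exp.
by congr (_ ^+ _ * _ * _); apply: eq_bigr => j _; rewrite dec_partK.
Qed.

(** The same sequence has two limits, one through the series and one entrywise through the
    determinant; [(1 - z^2)^m] comes out of the [m] rows. *)
Lemma newton_series_Cauchy (e : nat -> C) x y s :
  (forall eps, 0 < eps -> \forall n \near \oo, e n < eps) ->
  (forall N, `|s - partial_sum (newton_term x y) (box m N)| <= e N) ->
  on_torus x -> on_torus y -> vander x != 0 -> vander y != 0 ->
  s = cauchy_rhs zC x y.
Proof.
move=> esmall se x1 y1 vx vy.
have zn0 : zC != 0 by rewrite gt_eqF // ltcR.
have Ss : partial_sum (newton_term x y) (box m N) @[N --> \oo] --> s.
  apply/cvgrPdist_le => eps eps0; have := esmall _ eps0.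
  by apply: filterS => N /ltW; apply: le_trans.
have lim1 : vander x * vander y *
    (zC ^+ 'C(m, 2) * partial_sum (newton_term x y) (box m N)) @[N --> \oo] -->
    vander x * vander y * (zC ^+ 'C(m, 2) * s).
  exact: (cvgM (cvg_cst _) (cvgM (cvg_cst _) Ss)).
have lim2 : vander x * vander y *
    (zC ^+ 'C(m, 2) * partial_sum (newton_term x y) (box m N)) @[N --> \oo] -->
    \det ((1 - zC ^+ 2) *: \matrix_(i < m, j < m) cauchy_kernel zC (x 0 i) (y 0 j)).
  rewrite (_ : (fun N => _) = fun N => \det (\matrix_(i < m, j < m)
     \sum_(k < N) zC ^+ k * chebU (x 0 i) k * chebU (y 0 j) k)); last first.
    by apply: funext => N; rewrite sum_box_newton_term.
  apply: cvg_det => i j; rewrite !mxE.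
  rewrite (_ : (fun N => _) = fun N =>
     \sum_(k < N) zC ^+ k * chebU (x 0 i) k * chebU (y 0 j) k).
    exact: cvg_kernel_sum.
  by apply: funext => N; rewrite mxE.
have := cvg_unique (@norm_hausdorff _ _) lim1 lim2.
rewrite detZ /cauchy_rhs => <-; field.
by rewrite vx vy expf_neq0.
Qed.

End Series.

(** * Diagonalization by symplectic unitary matrices *)

Section SymplecticDiagonalization.
Variables (C : numClosedFieldType) (m : nat).
Local Notation J := (symplectic_form C m).
Local Notation cj A := (map_mx Num.conj A).
Implicit Types (g u d : 'M[C]_(m + m)) (a : 'rV[C]_m).

Lemma conj_mxK p q (A : 'M[C]_(p, q)) : cj (cj A) = A.
Proof. by apply/matrixP => i j; rewrite !mxE conjCK. Qed.

Lemma conj_tr_conj p q (A : 'M[C]_(p, q)) : cj (cj A)^T = A^T.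
Proof. by rewrite -map_trmx conj_mxK. Qed.

Lemma tr_symplectic_form : J^T = - J.
Proof.
by rewrite /symplectic_form tr_block_mx opp_block_mx !trmx0 linearN /= trmx1 oppr0 opprK.
Qed.

Lemma symplectic_form_sq : J *m J = - 1%:M.
Proof.
rewrite /symplectic_form mulmx_block !(mul0mx, mulmx0, mulmx1, mul1mx, addr0, add0r).
by rewrite [in RHS]scalar_mx_block opp_block_mx oppr0.
Qed.

Lemma conj_symplectic_form : cj J = J.
Proof.
by rewrite /symplectic_form map_block_mx !map_mx0 map_mxN map_mx1.
Qed.

Lemma unitary_conj_tr n (g : 'M[C]_n) : g \is unitarymx -> cj g *m g^T = 1%:M.
Proof.
move=> /unitarymxP e; have := congr1 (fun A => cj A) e.
by rewrite map_mxM conj_mxK map_mx1.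
Qed.

(* [g] commutes with the quaternionic structure [v |-> cj v *m J]. *)
Lemma Sp_conj g : Sp C m g <-> g \is unitarymx /\ J *m g = cj g *m J.
Proof.
split=> [[gu gJ]|[gu gJ]]; split=> //.
  by rewrite -[in RHS]gJ !mulmxA unitary_conj_tr // mul1mx.
rewrite -mulmxA gJ mulmxA.
by rewrite (mulmx1C (unitary_conj_tr gu)) mul1mx.
Qed.

Lemma Sp_conjugate u d : Sp C m u -> Sp C m d -> Sp C m (cj u^T *m d *m u).
Proof.
move=> /Sp_conj[uu uJ] /Sp_conj[du dJ]; apply/Sp_conj; split.
  by rewrite !mul_unitarymx ?trmxC_unitary.
have ucu : cj u^T *m u = 1%:M by apply: mulmx1C; apply/unitarymxP.
have uJ' : J *m cj u^T = cj (cj u^T) *m J.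
  have utcu : u^T *m cj u = 1%:M by apply: mulmx1C; apply: unitary_conj_tr.
  rewrite conj_mxK -[LHS]mul1mx -utcu -!mulmxA (mulmxA _ J) -uJ.
  by rewrite -mulmxA (unitarymxP uu) mulmx1.
by rewrite !map_mxM !mulmxA uJ' -!mulmxA (mulmxA J) dJ -mulmxA uJ.
Qed.

Lemma char_poly_unitary_conj n (u d : 'M[C]_n) : u \is unitarymx ->
  char_poly (cj u^T *m d *m u) = char_poly d.
Proof.
move=> uu; have ucu : cj u^T *m u = 1%:M by apply: mulmx1C; apply/unitarymxP.
pose P := map_mx polyC u; pose Q := map_mx polyC (cj u^T).
have QP : Q *m P = 1%:M by rewrite -map_mxM ucu map_mx1.
have -> : char_poly (cj u^T *m d *m u) = \det (Q *m char_poly_mx d *m P).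
  congr (\det _); rewrite /char_poly_mx mulmxBr mulmxBl !map_mxM -/P -/Q.
  by rewrite scalar_mxC -[X in _ = X - _]mulmxA QP mulmx1.
by rewrite !det_mulmx mulrAC -det_mulmx QP det1 mul1r.
Qed.

(** Inverse eigenvalues sit at positions [i] and [m + i], which [J] pairs; entries of modulus one
    give the diagonal maximal torus. *)
Definition sdiag a : 'M[C]_(m + m) := diag_mx (row_mx a (map_mx GRing.inv a)).

Lemma char_poly_sdiag a : eigenpairs (sdiag a) a.
Proof.
rewrite /eigenpairs char_poly_trig ?diag_mx_is_trig // big_split_ord /= -big_split /=.
apply: eq_bigr => i _.
by rewrite !mxE !eqxx !mulr1n (unsplitK (inl i)) (unsplitK (inr i)) !mxE.
Qed.

Lemma conj_unit (w : C) : `|w| = 1 -> w^* = w^-1.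
Proof. by move=> w1; rewrite invC_norm w1 expr1n invr1 mul1r. Qed.

Lemma sdiag_Sp a : (forall i, `|a 0 i| = 1) -> Sp C m (sdiag a).
Proof.
move=> a1.
have cs : cj (sdiag a) = diag_mx (row_mx (map_mx GRing.inv a) a).
  rewrite map_diag_mx map_row_mx; congr (diag_mx (row_mx _ _)); apply/rowP => i.
    by rewrite !mxE /= conj_unit.
  by rewrite !mxE /= conj_unit ?invrK // normfV a1 invr1.
have a0 i : a 0 i != 0 by rewrite -normr_gt0 a1.
apply/Sp_conj; split.
  apply/unitarymxP; rewrite -map_trmx cs tr_diag_mx mulmx_diag.
  rewrite -diag_const_mx; congr diag_mx; apply/rowP => i; rewrite !mxE.
  by case: (fintype.split i) => j; rewrite !mxE ?mulfV ?mulVf.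
rewrite cs /sdiag !diag_mx_row /symplectic_form !mulmx_block.
by rewrite !(mul0mx, mulmx0, mulmx1, mul1mx, addr0, add0r, mulNmx, mulmxN, oppr0).
Qed.

Section Extension.
Variable g : 'M[C]_(m + m).
Hypothesis gSp : Sp C m g.

(* [V *m J *m V^T = 0] says that the rows of [V] are orthogonal to the rows of
   [cj V *m J], which are then eigenvectors for the conjugate eigenvalues. *)
Definition eigenframe k (V : 'M[C]_(k, m + m)) (a : 'rV[C]_k) :=
  [/\ V *m cj V^T = 1%:M, V *m J *m V^T = 0 & V *m g = diag_mx a *m V].

Lemma eigenframe_norm k V (a : 'rV[C]_k) : eigenframe V a -> forall i, `|a 0 i| = 1.
Proof.
case=> VV _ Vg i; have [gu _] := gSp.
have : (V *m g) *m cj (V *m g)^T = 1%:M.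
  by rewrite trmx_mul map_mxM mulmxA -(mulmxA V) (unitarymxP gu) mulmx1.
rewrite Vg trmx_mul map_mxM mulmxA -(mulmxA _ V) VV mulmx1 tr_diag_mx map_diag_mx.
rewrite mulmx_diag => /matrixP /(_ i i); rewrite !mxE eqxx !mulr1n -normCK.
by move/eqP; rewrite sqrp_eq1 ?normr_ge0 // => /eqP.
Qed.

Lemma eigenframe_conj k V (a : 'rV[C]_k) : eigenframe V a ->
  cj V *m J *m g = diag_mx (cj a) *m (cj V *m J).
Proof.
case=> _ _ Vg; have /Sp_conj[_ gJ] := gSp.
by rewrite -mulmxA gJ mulmxA -map_mxM Vg map_mxM map_diag_mx mulmxA.
Qed.

(** The rows of [V] and of [cj V *m J] span a space stable under the unitary [g], and so its
    orthogonal complement is stable; a normalized eigenvector there is the new row. *)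
Lemma eigenframe_extend k V (a : 'rV[C]_k) : (k < m)%N -> eigenframe V a ->
  exists (V' : 'M[C]_(k.+1, m + m)) (a' : 'rV[C]_k.+1), eigenframe V' a'.
Proof.
move=> km fr; have [VV VJ Vg] := fr; have [gu _] := gSp.
pose W := col_mx V (cj V *m J).
pose D := diag_mx (row_mx a (cj a)).
have Wg : W *m g = D *m W.
  rewrite /W mul_col_mx Vg (eigenframe_conj fr) /D diag_mx_row mul_block_col.
  by rewrite !mul0mx addr0 add0r.
have DD : cj D^T *m D = 1%:M.
  rewrite tr_diag_mx map_diag_mx mulmx_diag -diag_const_mx; congr diag_mx.
  apply/rowP => i; rewrite !mxE.
  case: (fintype.split i) => j; rewrite ?mxE /= ?conjCK; [rewrite mulrC|];
  by rewrite -normCK (eigenframe_norm fr) expr1n.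
have gW : g *m cj W^T = cj W^T *m D.
  rewrite -[cj W^T in LHS]mulmx1 -DD !mulmxA; congr (_ *m _).
  rewrite -mulmxA -map_mxM -trmx_mul -Wg trmx_mul map_mxM mulmxA.
  by rewrite (unitarymxP gu) mul1mx.
(* The orthogonal complement of the rows of [W], nonzero because [2 k < 2 m]. *)
pose K := kermx (cj W^T).
have K0 : (0 < \rank K)%N.
  rewrite mxrank_ker subn_gt0; apply: leq_ltn_trans (rank_leq_col _) _.
  by rewrite -addnS leq_add // ltnW.
have Kg : (row_base K *m g <= row_base K)%MS.
  rewrite eq_row_base; apply/sub_kermxP.
  have bW : row_base K *m cj W^T = 0 by apply/sub_kermxP; rewrite eq_row_base.
  by rewrite -mulmxA gW mulmxA bW mul0mx.
(* [R] is the matrix of [g] on [K]; its eigenvectors lift to eigenvectors of [g]. *)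
have [R RK] := submxP Kg.
have [b /eigenvalueP[v vR v0]] := eigenvalue_closed R K0.
pose w0 := v *m row_base K.
have w00 : w0 != 0 by rewrite mulmx_free_eq0 ?row_base_free.
have w0g : w0 *m g = b *: w0.
  by rewrite /w0 -mulmxA RK mulmxA vR -scalemxAl.
have w0W : w0 *m cj W^T = 0.
  by rewrite /w0 -mulmxA (_ : row_base K *m _ = 0) ?mulmx0 //;
     apply/sub_kermxP; rewrite eq_row_base.
pose c := (w0 *m cj w0^T) 0 0.
have c0 : 0 < c.
  have := @dotmx_is_dotmx C _ _ w00; by rewrite dotmxE.
pose w := (sqrtC c)^-1 *: w0.
have ww : w *m cj w^T = 1%:M.
  rewrite /w linearZ /= map_mxZ -scalemxAl -scalemxAr scalerA.
  rewrite [w0 *m _]mx11_scalar -/c -mul_scalar_mx -scalar_mxM; congr (_%:M).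
  have s0 : 0 < sqrtC c by rewrite sqrtC_gt0.
  rewrite rmorphV ?unitfE ?gt_eqF //= (geC0_conj (ltW s0)).
  by rewrite -invfM -expr2 sqrtCK mulVf // gt_eqF.
have wg : w *m g = b *: w by rewrite /w -scalemxAl w0g !scalerA mulrC.
have wW : w *m cj W^T = 0 by rewrite /w -scalemxAl w0W scaler0.
move: wW; rewrite /W tr_col_mx map_row_mx mul_mx_row => /eqP.
rewrite row_mx_eq0 => /andP[/eqP wV /eqP].
rewrite trmx_mul map_mxM tr_symplectic_form map_mxN conj_symplectic_form.
rewrite conj_tr_conj mulNmx mulmxN mulmxA => /eqP; rewrite oppr_eq0 => /eqP wJV.
suff fr' : @eigenframe (1 + k) (col_mx w V) (row_mx b%:M a).
  by exists (col_mx w V), (row_mx b%:M a).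
split.
- rewrite tr_col_mx map_row_mx mul_col_row ww VV wV.
  have -> : V *m cj w^T = 0.
    by rewrite -[V]conj_mxK -map_mxM -[cj V]trmxK -trmx_mul map_trmx wV trmx0 map_mx0.
  by rewrite -scalar_mx_block.
- rewrite tr_col_mx mul_col_mx mul_col_row VJ wJV.
  have tw (p q : nat) (A : 'M[C]_(p, m + m)) (B : 'M[C]_(q, m + m)) :
      (A *m J *m B^T)^T = - (B *m J *m A^T).
    by rewrite !trmx_mul trmxK tr_symplectic_form mulNmx mulmxN mulmxA.
  have -> : V *m J *m w^T = 0 by rewrite -[LHS]opprK -tw wJV trmx0 oppr0.
  (* A [1 x 1] matrix equal to its own opposite, [J] being antisymmetric. *)
  have -> : w *m J *m w^T = 0.
    have := tw _ _ w w; rewrite [w *m J *m w^T]mx11_scalar tr_scalar_mx.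
    move: (_ 0 0) => e /matrixP/(_ 0 0); rewrite !mxE eqxx !mulr1n => /eqP.
    by rewrite -addr_eq0 -mulr2n mulrn_eq0 /= => /eqP ->; rewrite raddf0.
  by rewrite block_mx0.
rewrite mul_col_mx wg Vg diag_mx_row mul_block_col !mul0mx addr0 add0r.
by rewrite -mul_scalar_mx; congr (col_mx (_ *m _) _); apply/matrixP => i j;
  rewrite !ord1 !mxE.
Qed.

(** A frame of [m] rows, completed by [cj V *m J], is a symplectic unitary matrix of
    eigenvectors. *)
Lemma symplectic_diagonalization : exists u a,
  [/\ Sp C m u, forall i, `|a 0 i| = 1 & g = cj u^T *m sdiag a *m u].
Proof.
have [V [a fr]] : exists (V : 'M[C]_(m, m + m)) a, eigenframe V a.
  suff: forall k, (k <= m)%N -> exists (V : 'M[C]_(k, m + m)) (a : 'rV[C]_k), eigenframe V a.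
    by apply.
  elim=> [|k IH] km.
    by exists 0, 0; split; rewrite ?mul0mx //; apply/matrixP => -[].
  by have [V [a fr]] := IH (ltnW km); apply: eigenframe_extend fr.
have [VV VJ Vg] := fr; have a1 := eigenframe_norm fr.
pose u := col_mx V (cj V *m J).
have uu : u \is unitarymx.
  apply/unitarymxP; rewrite /u tr_col_mx map_row_mx mul_col_row VV.
  rewrite trmx_mul map_mxM tr_symplectic_form map_mxN conj_symplectic_form.
  rewrite conj_tr_conj mulNmx !mulmxN !mulmxA VJ oppr0.
  rewrite -(mulmxA _ J J) symplectic_form_sq mulmxN mulmx1 mulNmx opprK.
  have -> : cj V *m V^T = 1%:M.
    by have := congr1 (fun A => cj A) VV; rewrite map_mxM conj_mxK map_mx1.
  have -> : cj V *m J *m cj V^T = 0.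
    by rewrite -[J]conj_symplectic_form -!map_mxM VJ map_mx0.
  by rewrite -scalar_mx_block.
exists u, a; split=> //.
  apply/Sp_conj; split=> //.
  rewrite /u map_col_mx map_mxM conj_mxK conj_symplectic_form (mul_col_mx (cj V)).
  rewrite -mulmxA symplectic_form_sq mulmxN mulmx1.
  rewrite -[J in LHS]/(block_mx 0 1%:M (- 1%:M) 0) mul_block_col.
  by rewrite !mul0mx add0r addr0 mulNmx !mul1mx.
have ug : u *m g = sdiag a *m u.
  rewrite /u mul_col_mx Vg (eigenframe_conj fr) /sdiag diag_mx_row mul_block_col.
  rewrite !mul0mx addr0 add0r; congr (col_mx _ (diag_mx _ *m _)).
  by apply/rowP => i; rewrite !mxE /= conj_unit.
rewrite -mulmxA -ug mulmxA.
have -> : cj u^T *m u = 1%:M by apply: mulmx1C; apply/unitarymxP.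
by rewrite mul1mx.
Qed.

End Extension.
End SymplecticDiagonalization.

(** * Matching two lists of eigenvalue pairs *)

Section EigenvalueMatching.
Variables (C : numClosedFieldType) (m : nat).
Implicit Types (x a : 'rV[C]_m).

Definition pair_poly x : {poly C} :=
  \prod_(i < m) (('X - (x 0 i)%:P) * ('X - ((x 0 i)^-1)%:P)).

Lemma pair_poly_norm a x : (forall i, `|a 0 i| = 1) -> pair_poly a = pair_poly x ->
  forall i, `|x 0 i| = 1.
Proof.
move=> a1 e i; have : root (pair_poly a) (x 0 i).
  by rewrite e /root horner_prod (bigD1 i) //= !hornerE subrr !mul0r.
rewrite /root horner_prod prodf_seq_eq0 => /hasP[j _] /=.
rewrite !hornerE mulf_eq0 !subr_eq0 => /orP[] /eqP ->; first exact: a1.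
by rewrite normfV a1 invr1.
Qed.

Lemma trace_eq (u v : C) : u != 0 -> v != 0 -> u + u^-1 = v + v^-1 ->
  (u == v) || (u == v^-1).
Proof.
move=> u0 v0 e.
have : (u - v) * (u - v^-1) = 0.
  have -> : (u - v) * (u - v^-1) = u * (u + u^-1 - (v + v^-1)).
    by field; rewrite u0 v0.
  by rewrite e subrr mulr0.
by move/eqP; rewrite mulf_eq0 !subr_eq0.
Qed.

(** [w] is a root of [X^2 - v X + 1], whose other root is [v - w = w^-1]. *)
Lemma trace_surj (v : C) : exists2 w, w != 0 & w + w^-1 = v.
Proof.
pose r := sqrtC (v ^+ 2 - 4%:R); pose w := (v + r) / 2%:R.
have e : w * (v - w) = 1.
  have -> : w * (v - w) = (v ^+ 2 - r ^+ 2) / 4%:R by rewrite /w; field.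
  by rewrite sqrtCK subKr mulfV // pnatr_eq0.
have w0 : w != 0 by apply: contra_eq_neq e => ->; rewrite mul0r eq_sym oner_eq0.
by exists w => //; rewrite -[w^-1]mulr1 -e mulKf // addrC subrK.
Qed.

(* At [w] both sides are [w ^+ m] times a product over the traces
   [x i + (x i)^-1] evaluated at [w + w^-1], which takes every value. *)
Lemma pair_poly_perm a x : (forall i, a 0 i != 0) -> (forall i, x 0 i != 0) ->
  pair_poly a = pair_poly x ->
  exists s : 'S_m, forall i, (x 0 i == a 0 (s i)) || (x 0 i == (a 0 (s i))^-1).
Proof.
move=> a0 x0 e; pose t (y : 'rV[C]_m) : m.-tuple C := [tuple y 0 i + (y 0 i)^-1 | i < m].
have ev (y : 'rV[C]_m) w : (forall i, y 0 i != 0) -> w != 0 -> (pair_poly y).[w] =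
    w ^+ m * (\prod_(i < m) ('X - (y 0 i + (y 0 i)^-1)%:P)).[w + w^-1].
  move=> y0 w0; rewrite !horner_prod -[in X in _ = w ^+ X * _](card_ord m) -prodr_const.
  rewrite -big_split /=; apply: eq_bigr => i _; rewrite !hornerE.
  by field; rewrite y0 w0.
have eP : \prod_(i < m) ('X - (a 0 i + (a 0 i)^-1)%:P) =
    \prod_(i < m) ('X - (x 0 i + (x 0 i)^-1)%:P).
  apply/eqP; rewrite -subr_eq0; apply/negPn/negP => /closed_nonrootP[v].
  have [w w0 <-] := trace_surj v; rewrite /root hornerD hornerN subr_eq0 => /negP; apply.
  apply/eqP; apply: (mulfI (expf_neq0 m w0)); rewrite -!ev //.
  by rewrite e.
have tE (y : 'rV[C]_m) : \prod_(i < m) ('X - (y 0 i + (y 0 i)^-1)%:P) = \prod_(z <- t y) ('X - z%:P).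
  by rewrite big_map big_enum.
have := eP; rewrite !tE => /prod_XsubC_eq; rewrite perm_sym => /tuple_permP[s sE].
exists s => i; apply: trace_eq => //.
have /(congr1 (fun l => tnth l i)) := val_inj sE.
by rewrite !tnth_mktuple.
Qed.

End EigenvalueMatching.

(** * Perturbation of eigenvalues along the unit circle *)

Section CirclePath.
Variable R : realType.
Local Notation C := (Cplx R).

(* Points [(1 + i h) / (1 - i h)] of the unit circle, for [h = 1 / (n + 1)]. *)
Definition circle_seq (n : nat) : C :=
  (1 + 'i * n.+1%:R^-1) / (1 - 'i * n.+1%:R^-1).

Let h (n : nat) : C := n.+1%:R^-1.

Let h_real n : h n \is Num.real.
Proof. by rewrite realV realn. Qed.

Let conjh n : (1 + 'i * h n)^* = 1 - 'i * h n.
Proof.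
by rewrite rmorphD rmorph1 rmorphM /= conjCi (CrealP (h_real n)) mulNr.
Qed.

Let den0 n : 1 - 'i * h n != 0.
Proof.
rewrite -conjh conjC_eq0; apply/eqP => e.
have := congr1 (fun w => 'Re w) e.
by rewrite Re_rect ?rpred1 ?h_real // raddf0 => /eqP; rewrite oner_eq0.
Qed.

Lemma circle_seq_norm n : `|circle_seq n| = 1.
Proof. by rewrite normf_div -/(h n) -conjh norm_conjC divff // normr_eq0 -conjC_eq0 conjh. Qed.

Lemma circle_seq_inj : injective circle_seq.
Proof.
move=> n k; rewrite /circle_seq -!/(h _) => /eqP; rewrite eqr_div // => /eqP e.
have : 2%:R * 'i * (h n - h k) = 0.
  have -> : 2%:R * 'i * (h n - h k) =
    (1 + 'i * h n) * (1 - 'i * h k) - (1 + 'i * h k) * (1 - 'i * h n) by ring.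
  by rewrite e subrr.
move/eqP; rewrite !mulf_eq0 pnatr_eq0 (negPf (neq0Ci _)) /= subr_eq0 => /eqP.
by move/invr_inj/eqP; rewrite eqr_nat => /eqP[].
Qed.

Lemma circle_seq_cvg : circle_seq n @[n --> \oo] --> (1 : C).
Proof.
have h0 : h n @[n --> \oo] --> (0 : C).
  apply/cvgrPdist_lt => -[e e']; rewrite ltcE /= => /andP[/eqP -> e0].
  have /cvgrPdist_lt /(_ e e0) := @cvg_harmonic R.
  apply: filterS => n; rewrite !sub0r !normrN !ger0_norm ?invr_ge0 ?ler0n // => H.
  by rewrite /h -[n.+1%:R](rmorph_nat (real_complex R)) -fmorphV /= ltcR.
have ih0 : 'i * h n @[n --> \oo] --> (0 : C).
  by rewrite -[X in _ --> X](mulr0 'i); apply: cvgM h0; exact: cvg_cst.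
rewrite -[X in _ --> X](divr1 1) -{1}[1]addr0 -[X in _ / X]subr0.
apply: cvgM; first by apply: cvgD ih0; exact: cvg_cst.
apply: cvgV; first by rewrite subr0 oner_eq0.
by apply: cvgB ih0; exact: cvg_cst.
Qed.

(** There are finitely many roots, and the injective sequence meets each at most once. *)
Lemma circle_seq_nonroot (p : {poly C}) : p != 0 ->
  \forall n \near \oo, p.[circle_seq n] != 0.
Proof.
move=> p0; have [s ps] := closed_field_poly_normal p.
have near_s : \forall n \near \oo, circle_seq n \notin s.
  elim: (s) => [|w l IH]; first by apply: nearW.
  have near_w : \forall n \near \oo, circle_seq n != w.
    have [[k kw]|nw] := pselect (exists k, circle_seq k = w).
      exists k.+1 => // n /= kn; apply/eqP => nw.
      by have := circle_seq_inj (etrans kw (esym nw)) => kn'; rewrite kn' ltnn in kn.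
    by apply: nearW => n; apply/eqP => nw'; apply: nw; exists n.
  by apply: filterS2 near_w IH => n nw nl; rewrite inE negb_or nw.
apply: filterS near_s => n; apply: contra => r.
rewrite -root_prod_XsubC; move: r; rewrite ps hornerZ mulf_eq0 lead_coef_eq0 (negPf p0).
exact.
Qed.

(** The exponents [i + 1] are positive and distinct, so that for the rotated entries [y i] both
    [y i * y j = 1] and, for [i != j], [y i = y j] become nontrivial polynomial equations in [w]. *)
Definition rotate m (x : 'rV[C]_m) (w : C) : 'rV[C]_m := \row_i (x 0 i * w ^+ i.+1).

(** A zero of the Weyl denominator forces one of these equations; each polynomial is nonzero at 0,
    so [w] avoids its roots eventually. *)
Lemma rotate_weyl_den m (x : 'rV[C]_m) : (forall i, x 0 i != 0) ->
  \forall n \near \oo, weyl_den (rotate x (circle_seq n)) != 0.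
Proof.
move=> x0.
have prod1 : \forall n \near \oo, forall i j : 'I_m,
    x 0 i * x 0 j * circle_seq n ^+ (i.+1 + j.+1) != 1.
  apply: filter_forall => i; apply: filter_forall => j.
  pose p : {poly C} := (x 0 i * x 0 j) *: 'X^(i.+1 + j.+1) - 1.
  have p0 : p != 0.
    apply/eqP => /(congr1 (fun q => q.[0])); rewrite !hornerE expr0n /= mulr0 sub0r.
    by move/eqP; rewrite oppr_eq0 oner_eq0.
  by apply: filterS (circle_seq_nonroot p0) => n; rewrite !hornerE subr_eq0.
have ratio : \forall n \near \oo, forall i j : 'I_m, (i < j)%N ->
    x 0 i != x 0 j * circle_seq n ^+ (j - i).
  apply: filter_forall => i; apply: filter_forall => j.
  have [ij|ji] := ltnP i j; last by apply: nearW.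
  pose p : {poly C} := (x 0 i)%:P - x 0 j *: 'X^(j - i).
  have p0 : p != 0.
    apply/eqP => /(congr1 (fun q => q.[0])); rewrite !hornerE expr0n.
    have -> : (j - i == 0)%N = false by apply/negbTE; rewrite subn_eq0 -ltnNge.
    by rewrite mulr0 subr0 => /eqP; rewrite (negPf (x0 i)).
  by apply: filterS (circle_seq_nonroot p0) => n; rewrite !hornerE subr_eq0 => + _.
apply: filterS2 prod1 ratio => n H1 H2.
have w0 : circle_seq n != 0 by rewrite -normr_gt0 circle_seq_norm.
have y0 i : rotate x (circle_seq n) 0 i != 0 by rewrite mxE mulf_neq0 ?expf_neq0.
have H1' i j : rotate x (circle_seq n) 0 i * rotate x (circle_seq n) 0 j != 1.
  by rewrite !mxE mulrACA -exprD.
rewrite weyl_denE // mulf_neq0 //; apply/prodf_neq0 => i _.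
  rewrite subr_eq0; apply: contra_neq (H1' i i) => {1}->.
  by rewrite mulVf.
apply/prodf_neq0 => j ij; rewrite subr_eq0; apply/negP => /eqP /(trace_eq (y0 i) (y0 j)).
case/orP => /eqP e.
  move: (H2 i j ij) => /eqP; apply; move: e; rewrite !mxE => e.
  apply: (mulIf (expf_neq0 i.+1 w0)); rewrite e -mulrA -exprD; congr (_ * _ ^+ _).
  by rewrite addnS subnK // ltnW.
by move: (H1' i j); rewrite e mulVf // eqxx.
Qed.

End CirclePath.

(** * Entrywise limits of matrix products and diagonal matrices *)

Section MatrixLimits.
Variables (C : numClosedFieldType) (T : Type) (F : set_system T).
Hypothesis FF : Filter F.

Lemma cvg_mulmx p q r (A : T -> 'M[C]_(p, q)) (B : T -> 'M[C]_(q, r))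
    (A' : 'M[C]_(p, q)) (B' : 'M[C]_(q, r)) :
  (forall i j, A t i j @[t --> F] --> A' i j) ->
  (forall i j, B t i j @[t --> F] --> B' i j) ->
  forall i j, (A t *m B t) i j @[t --> F] --> (A' *m B') i j.
Proof.
move=> AA BB i j; rewrite mxE (_ : (fun t => _) = fun t => \sum_k A t i k * B t k j).
  by apply: cvg_sum_seq => k _; apply: cvgM.
by apply: funext => t; rewrite mxE.
Qed.

Lemma cvg_sdiag m (a : T -> 'rV[C]_m) (a' : 'rV[C]_m) :
  (forall i, a t 0 i @[t --> F] --> a' 0 i) -> (forall i, a' 0 i != 0) ->
  forall i j, sdiag (a t) i j @[t --> F] --> sdiag a' i j.
Proof.
move=> aa a0 i j.
have sE (y : 'rV[C]_m) : sdiag y i j =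
    match fintype.split i with inl p => y 0 p | inr p => (y 0 p)^-1 end *+ (i == j).
  by rewrite !mxE; case: (fintype.split i) => p; rewrite ?mxE.
rewrite sE (_ : (fun t => _) = fun t =>
    match fintype.split i with inl p => a t 0 p | inr p => (a t 0 p)^-1 end *+ (i == j)).
  case: (i == j); last by rewrite !mulr0n; exact: cvg_cst.
  rewrite !mulr1n; case: (fintype.split i) => p; first exact: aa.
  by apply: cvgV; [exact: a0|exact: aa].
by apply: funext => t; rewrite sE.
Qed.

End MatrixLimits.

(** * Values of the characters at all group elements *)

Section CharacterValues.
Variables (R : realType) (m : nat).
Local Notation C := (Cplx R).
Implicit Types (g u : 'M[C]_(m + m)) (x a : 'rV[C]_m).

Lemma eigenpairs_norm g x : Sp C m g -> eigenpairs g x -> forall i, `|x 0 i| = 1.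
Proof.
move=> gSp gx; have [u [a [[uu _] a1 gE]]] := symplectic_diagonalization gSp.
apply: (pair_poly_norm a1); rewrite /pair_poly -gx gE char_poly_unitary_conj //.
by rewrite char_poly_sdiag.
Qed.

(** On the group the character is the trace of [rho], whose continuity is relative to [Sp]; the
    sequence therefore stays in the group. *)
Lemma character_cvg (chi : 'M[C]_(m + m) -> C) (G : nat -> 'M[C]_(m + m)) g :
  irreducible_character chi -> Sp C m g -> (forall n, Sp C m (G n)) ->
  (forall i j, G n i j @[n --> \oo] --> g i j) ->
  chi (G n) @[n --> \oo] --> chi g.
Proof.
move=> [d [rho [rhoP chiE]]] gSp GSp Gg.
have rhoc : rho (G n) @[n --> \oo] --> rho g.
  have /subspace_continuousP /(_ g gSp) rho_cont := irr_cont rhoP.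
  move=> U /rho_cont gU.
  have : \forall n \near \oo, Sp C m (G n) -> U (rho (G n)).
    exact: (cvg_mx_coord _ Gg gU).
  by apply: filterS => n; apply.
rewrite chiE //; under eq_cvg do rewrite chiE //.
apply: cvg_sum_seq => i _.
exact: (cvg_comp (fun n => rho (G n)) (fun M : 'M[C]_d => M i i) rhoc
  (@coord_continuous _ d d i i (rho g))).
Qed.

(* Where the Weyl denominator vanishes, [g] is a limit of the elements with
   eigenvalues [x i * w ^+ i.+1], [w] tending to 1 on the unit circle, which
   are eventually regular. *)
Lemma sp_character_newton l chi g x : sp_character l chi -> Sp C m g ->
  eigenpairs g x -> chi g = newton_det (part_exp l) x.
Proof.
move=> [chi_irr weyl] gSp gx.
have x1 := eigenpairs_norm gSp gx.
have x0 i : x 0 i != 0 by rewrite -normr_gt0 x1.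
have [u [a [uSp a1 gE]]] := symplectic_diagonalization gSp; have [uu _] := uSp.
have a0 i : a 0 i != 0 by rewrite -normr_gt0 a1.
have ax : pair_poly a = pair_poly x.
  by rewrite /pair_poly -gx gE (char_poly_unitary_conj _ uu) char_poly_sdiag.
have [s sP] := pair_poly_perm a0 x0 ax.
pose X n := rotate x (circle_seq R n).
(* [A n] follows the matching [s]: it takes the rotated entry where [a] has [x i] and its inverse
   elsewhere, so that it tends to [a]. *)
pose A n : 'rV[C]_m := \row_j let i := (s^-1)%g j in
  if x 0 i == a 0 j then X n 0 i else (X n 0 i)^-1.
pose G n := map_mx Num.conj u^T *m sdiag (A n) *m u.
have X1 n i : `|X n 0 i| = 1 by rewrite mxE normrM normrX circle_seq_norm expr1n x1 mulr1.
have A1 n j : `|A n 0 j| = 1.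
  by rewrite mxE /=; case: ifP => _; rewrite ?normfV X1 ?invr1.
have GSp n : Sp C m (G n) by exact: (Sp_conjugate uSp (sdiag_Sp (A1 n))).
have GX n : eigenpairs (G n) (X n).
  rewrite /eigenpairs (char_poly_unitary_conj _ uu) char_poly_sdiag.
  rewrite (reindex_inj (@perm_inj _ s)) /=; apply: eq_bigr => i _.
  rewrite [A n 0 (s i)]mxE /= permK; case: ifP => _ //.
  by rewrite invrK mulrC.
have Xx i : X n 0 i @[n --> \oo] --> x 0 i.
  have wk k : circle_seq R n ^+ k @[n --> \oo] --> (1 : C).
    elim: k => [|k IH]; first exact: cvg_cst.
    rewrite -[X in _ --> X]mulr1 (_ : (fun n => _) =
      (fun n => circle_seq R n * circle_seq R n ^+ k)).
      by apply: cvgM IH; exact: circle_seq_cvg.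
    by apply: funext => n; rewrite exprS.
  rewrite -[X in _ --> X]mulr1 (_ : (fun n => _) =
    (fun n => x 0 i * circle_seq R n ^+ i.+1)).
    by apply: cvgM (wk _); exact: cvg_cst.
  by apply: funext => n; rewrite mxE.
have Aa j : A n 0 j @[n --> \oo] --> a 0 j.
  under eq_cvg do rewrite mxE /=.
  have := sP ((s^-1)%g j); rewrite permKV.
  case: eqP => [e _|_ /= /eqP e]; first by rewrite -e; apply: Xx.
  by rewrite -[a 0 j]invrK -e; apply: cvgV; [exact: x0|exact: Xx].
have Gg i j : G n i j @[n --> \oo] --> g i j.
  rewrite gE; apply: cvg_mulmx => [p q|p q]; last exact: cvg_cst.
  apply: cvg_mulmx => [p' q'|]; first exact: cvg_cst.
  exact: cvg_sdiag.
have lim1 := character_cvg chi_irr gSp GSp Gg.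
have lim2 := cvg_newton_det (k := part_exp l) _ Xx x0.
apply: (cvg_unique (@norm_hausdorff _ _) lim1).
have eqn : \forall n \near \oo, chi (G n) = newton_det (part_exp l) (X n).
  apply: filterS (rotate_weyl_den x0) => n den.
  have X0 i : X n 0 i != 0 by rewrite -normr_gt0 X1.
  by rewrite (weyl _ _ (GSp n) (GX n) den) weyl_numE // mulrC mulKf.
by move=> U /lim2 nU; apply: filterS2 eqn nU => n /= ->.
Qed.

End CharacterValues.

(** * Summation of the character series and its limit at singular eigenvalues *)

Theorem theorem3p7 (R : realType) (m : nat) (hm : (1 <= m)%N)
    (sp : mpartition m -> 'M[Cplx R]_(m + m) -> Cplx R)
    (hsp : forall l : mpartition m, sp_character l (sp l))
    (g h : 'M[Cplx R]_(m + m)) (hg : Sp (Cplx R) m g) (hh : Sp (Cplx R) m h)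
    (x y : 'rV[Cplx R]_m) (hx : eigenpairs g x) (hy : eigenpairs h y)
    (z : R) (hz0 : 0 < z) (hz1 : z < 1) :
  let zC : Cplx R := (z%:C)%C in
  exists s : Cplx R,
    [/\ partial_sum (fun l : mpartition m => zC ^+ weight l * sp l g * sp l h)
          @ totally --> s,
        vander x != 0 -> vander y != 0 -> s = cauchy_rhs zC x y
      & (fun p => cauchy_rhs zC p.1 p.2)
          @ within (regular_pairs (Cplx R) m) (nbhs (x, y)) --> s].
Proof.
move=> zC.
have x1 := eigenpairs_norm hg hx; have y1 := eigenpairs_norm hh hy.
have -> : (fun l : mpartition m => zC ^+ weight l * sp l g * sp l h) =
    newton_term z x y.
  apply: funext => l; rewrite /newton_term (sp_character_newton (hsp l) hg hx).
  by rewrite (sp_character_newton (hsp l) hh hy).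
have [e esmall uniform] := newton_series m hz0 hz1.
have [s Hs] := uniform x y x1 y1.
have totF := @totally_filter (mpartition m).
exists s; split.
- apply/cvgrPdist_le => eps eps0; have [N _ /(_ N (leqnn N)) eN] := esmall _ eps0.
  exists (box m N) => // A NA.
  exact: le_trans (Hs N A NA) (ltW eN).
- move=> vx vy; apply: (newton_series_Cauchy hz0 hz1 esmall _ x1 y1 vx vy) => N.
  by apply: Hs; apply: fsubset_refl.
set W := within _ _; have WF : Filter W by exact: within_filter.
have coord1 i : (fun p : 'rV[Cplx R]_m * 'rV[Cplx R]_m => p.1 0 i) @ W --> x 0 i.
  apply: cvg_within_filter.
  exact: (cvg_comp fst (fun M : 'rV[Cplx R]_m => M 0 i) cvg_fst
    (@coord_continuous _ 1 m 0 i x)).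
have coord2 i : (fun p : 'rV[Cplx R]_m * 'rV[Cplx R]_m => p.2 0 i) @ W --> y 0 i.
  apply: cvg_within_filter.
  exact: (cvg_comp snd (fun M : 'rV[Cplx R]_m => M 0 i) cvg_snd
    (@coord_continuous _ 1 m 0 i y)).
apply/cvgrPdist_le => eps eps0.
have eps30 : 0 < eps / 3%:R by rewrite divr_gt0.
have [N _ /(_ N (leqnn N)) eN] := esmall _ eps30.
(* Three thirds of [eps]: the uniform tail at [(x, y)], the continuity of the finite sum [S], and
   the uniform tail at a nearby regular pair, where the series equals [cauchy_rhs]. *)
pose S (p : 'rV[Cplx R]_m * 'rV[Cplx R]_m) :=
  partial_sum (newton_term z p.1 p.2) (box m N).
have Scvg : S p @[p --> W] --> S (x, y).
  have -> : S = fun p => \sum_(l <- box m N) newton_term z p.1 p.2 l.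
    by apply: funext => p; rewrite /S partial_sum_seq.
  apply: cvg_sum_seq => l _; apply: cvgM.
    by apply: cvgM; [exact: cvg_cst|exact: cvg_newton_det _ coord1 (torus_neq0 x1)].
  exact: cvg_newton_det _ coord2 (torus_neq0 y1).
have WD : \forall p \near W, regular_pairs (Cplx R) m p by exact: withinT.
move/cvgrPdist_le: Scvg => /(_ _ eps30); apply: filterS2 WD => -[u v] [u1 v1 vu vv] Suv.
have [s' Hs'] := uniform u v u1 v1.
have <- : s' = cauchy_rhs zC u v.
  apply: (newton_series_Cauchy hz0 hz1 esmall _ u1 v1 vu vv) => k.
  by apply: Hs'; apply: fsubset_refl.
have -> : s - s' = (s - S (x, y)) + (S (x, y) - S (u, v)) + (S (u, v) - s').
  by rewrite !subrKA.
have -> : eps = eps / 3%:R + eps / 3%:R + eps / 3%:R by field.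
apply: le_trans (ler_normD _ _) _; apply: lerD; last first.
  by rewrite distrC; apply: le_trans (Hs' N _ (fsubset_refl _)) (ltW eN).
apply: le_trans (ler_normD _ _) _; apply: (lerD _ Suv).
exact: le_trans (Hs N _ (fsubset_refl _)) (ltW eN).
Qed.
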